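(* Let $(E,\langle\cdot,\cdot\rangle,\pi,[\cdot,\cdot])$ be an odd exact Courant algebroid over an $n$-dimensional manifold $M$ and let $(G,\mathcal F)$ be a $B_n$-generalized almost pseudo-Hermitian structure on $E$. Then $(G,\mathcal F)$ is integrable if and only if there is a torsion-free generalized connection $D$ on $E$ which preserves $(G,\mathcal F)$, i.e. $DG=0$ and $D\mathcal F=0$.
   Context: A Courant algebroid over a smooth manifold $M$ is a real vector bundle $E\to M$ with a non-degenerate symmetric bilinear form $\langle\cdot,\cdot\rangle$ (scalar product), a bundle map $\pi:E\to TM$ (anchor) and an $\mathbb R$-bilinear bracket $[\cdot,\cdot]$ on $\Gamma(E)$ (Dorfman bracket) such that for all $u,v,w\in\Gamma(E)$, $f\in C^\infty(M)$: $[u,[v,w]]=[[u,v],w]+[v,[u,w]]$; $[u,fv]=f[u,v]+\pi(u)(f)v$; $\pi(u)\langle v,w\rangle=\langle[u,v],w\rangle+\langle v,[u,w]\rangle$; $\langle[u,v]+[v,u],w\rangle=\pi(w)\langle u,v\rangle$. With $n=\dim M$, it is odd exact (of type $B_n$) if $\pi$ is surjective and $\langle\cdot,\cdot\rangle$ has signature $(n+1,n)$ (so $\mathrm{rank}\,E=2n+1$). The bracket, anchor and scalar product are extended complex-linearly to $E^{\mathbb C}=E\otimes\mathbb C$. A generalized connection on $E$ is an $\mathbb R$-linear map $D:\Gamma(E)\to\Gamma(E^*\otimes E)$, $u\mapsto Du$, with $D_v(fu)=\pi(v)(f)u+fD_vu$ and $\pi(w)\langle u,v\rangle=\langle D_wu,v\rangle+\langle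 u,D_wv\rangle$. Its torsion $T^D\in\Gamma(\Lambda^3E^* )$ is $T^D(u,v,w)=\langle D_uv-D_vu-[u,v],w\rangle+\langle D_wu,v\rangle$; $D$ is torsion-free if $T^D=0$. $D$ is extended to tensors on $E$ in the usual way. A $B_n$-generalized almost complex structure on $E$ is a $\langle\cdot,\cdot\rangle$-skew-symmetric endomorphism $\mathcal F\in\Gamma(\mathrm{End}\,E)$ of rank $2n$ with $\mathcal F^2=-\mathrm{Id}+(-1)^n\langle\cdot,u_0\rangle u_0$ for a section $u_0\in\Gamma(E)$ with $\langle u_0,u_0\rangle=(-1)^n$ ($u_0$ is unique up to sign and spans $\mathrm{Ker}\,\mathcal F$). It is integrable (a $B_n$-generalized complex structure) if the sections of its $i$-eigenbundle $L\subset E^{\mathbb C}$ are closed under the Dorfman bracket. A generalized (admissible) metric on $E$ is a subbundle $E_-\subset E$ such that $\langle\cdot,\cdot\rangle|_{E_-}$ is non-degenerate and $\pi|_{E_-}:E_-\to TM$ is an isomorphism. Put $E_+:=(E_-)^\perp$, let $G^{\mathrm{end}}\in\Gamma(\mathrm{End}\,E)$ be defined by $G^{\mathrm{end}}|_{E_\pm}=\pm\mathrm{Id}$, and $G(u,v):=\langle G^{\mathrm{end}}u,v\rangle$; one refers to $G$ as the generalized metric. A $B_n$-generalized almost pseudo-Hermitian structure is a pair $(G,\mathcal F)$ of a generalized metric and a $B_n$-generalized almost complex structure with $G^{\mathrm{end}}\mathcal F=\mathcal FG^{\mathrm{end}}$; then $G^{\mathrm{end}}\mathcal F$ is also a $B_n$-generalized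 almost complex structure. $(G,\mathcal F)$ is integrable (a $B_n$-generalized pseudo-Kähler structure) if both $\mathcal F$ and $G^{\mathrm{end}}\mathcal F$ are integrable. *)

(* Defs.v *)
From HB Require Import structures.
From mathcomp Require Import all_boot all_order all_algebra.
From mathcomp Require Import all_classical all_reals all_analysis.

Set Implicit Arguments.
Unset Strict Implicit.
Unset Printing Implicit Defensive.

Import Order.TTheory GRing.Theory Num.Theory.
Import numFieldNormedType.Exports.

Local Open Scope classical_set_scope.
Local Open Scope ring_scope.

Section EuclideanSmoothness.
Variables (R : realType) (n : nat).

(* Meaningful for [U] open only: continuity and derivability at a point of [U]
   are taken in the whole space. *)
Fixpoint Ck_on (k : nat) (U : set 'rV[R]_n) (f : 'rV[R]_n -> R) : Prop :=
  {in U, continuous f} /\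
  if k is k'.+1 then
    forall i : 'I_n,
      (forall x, U x -> derivable f x (delta_mx 0 i)) /\
      Ck_on k' U (fun x => 'D_(delta_mx 0 i) f x)
  else True.

Definition Cinf_on (U : set 'rV[R]_n) (f : 'rV[R]_n -> R) : Prop :=
  forall k, Ck_on k U f.

End EuclideanSmoothness.

(* [chart_map] and [chart_inv] are mutually inverse homeomorphisms between the
   open set [chart_dom] and its open image; their values elsewhere are
   irrelevant. *)
Record chart (R : realType) (n : nat) (M : topologicalType) := Chart {
  chart_dom : set M;
  chart_map : M -> 'rV[R]_n;
  chart_inv : 'rV[R]_n -> M;
  chart_dom_open : open chart_dom;
  chart_img_open : open (chart_map @` chart_dom);
  chart_mapK : forall p, chart_dom p -> chart_inv (chart_map p) = p;
  chart_map_continuous : {in chart_dom, continuous chart_map};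
  chart_inv_continuous : {in chart_map @` chart_dom, continuous chart_inv}
}.

(* The atlas is not required to be maximal. *)
Record manifold (R : realType) (n : nat) := Manifold {
  manifold_space :> topologicalType;
  manifold_hausdorff : hausdorff_space manifold_space;
  manifold_second_countable : @second_countable manifold_space;
  atlas : set (chart R n manifold_space);
  atlas_cover : forall p, exists2 c, atlas c & chart_dom c p;
  atlas_smooth : forall c c', atlas c -> atlas c' -> forall i : 'I_n,
    Cinf_on (chart_map c @` (chart_dom c `&` chart_dom c'))
            (fun x => chart_map c' (chart_inv c x) 0 i)
}.

Section SmoothFunctions.
Variables (R : realType) (n : nat) (M : manifold R n).

(* Meaningful for [U] open only. *)
Definition smooth_on (U : set M) (f : M -> R) : Prop :=
  forall c, atlas c ->
    Cinf_on (chart_map c @` (chart_dom c `&` U)) (fun x => f (chart_inv c x)).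

Definition smooth (f : M -> R) : Prop := smooth_on setT f.

(* Tangent vectors at [p] are derivations at [p] of the algebra of smooth
   functions.  The values on non-smooth functions are irrelevant, so two tangent
   vectors are identified when they satisfy [tangent_eq]. *)
Record tangent (p : M) := Tangent {
  tangent_fun :> (M -> R) -> R;
  tangent_linear : forall (a : R) f g, smooth f -> smooth g ->
    tangent_fun (fun q => a * f q + g q) = a * tangent_fun f + tangent_fun g;
  tangent_leibniz : forall f g, smooth f -> smooth g ->
    tangent_fun (fun q => f q * g q) = tangent_fun f * g p + f p * tangent_fun g
}.

Definition tangent_eq (p : M) (X Y : tangent p) : Prop :=
  forall f, smooth f -> X f = Y f.

End SmoothFunctions.

Record local_frame (R : realType) (n : nat) (M : manifold R n) (r : nat)
    (E : M -> vectType R) := LocalFrame {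
  frame_dom : set M;
  frame_vec :> forall p, r.-tuple (E p);
  frame_dom_open : open frame_dom;
  frame_basis : forall p, frame_dom p -> basis_of fullv (frame_vec p)
}.

(* A bundle is a family of fibres together with local trivializations, given by
   local frames covering [M] with smooth transition matrices. *)
Record vector_bundle (R : realType) (n : nat) (M : manifold R n) (r : nat) :=
  VectorBundle {
  fibre :> M -> vectType R;
  frames : set (local_frame r fibre);
  frames_cover : forall p, exists2 e, frames e & frame_dom e p;
  frames_smooth : forall e e', frames e -> frames e' -> forall i j : 'I_r,
    smooth_on (frame_dom e `&` frame_dom e')
              (fun p => coord (e p) i (tnth (e' p) j))
}.

Section Bundles.
Variables (R : realType) (n : nat) (M : manifold R n) (r : nat).
Variable E : vector_bundle M r.

Definition section := forall p, E p.

Definition smooth_section_on (U : set M) (s : section) : Prop :=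
  forall e, frames e -> forall i : 'I_r,
    smooth_on (frame_dom e `&` U) (fun p => coord (e p) i (s p)).

Definition smooth_section (s : section) : Prop := smooth_section_on setT s.

Definition endo := forall p, 'End(E p).

Definition smooth_endo (A : endo) : Prop :=
  forall e, frames e -> forall i j : 'I_r,
    smooth_on (frame_dom e) (fun p => coord (e p) i (A p (tnth (e p) j))).

Definition smooth_form (b : forall p, E p -> E p -> R) : Prop :=
  forall e, frames e -> forall i j : 'I_r,
    smooth_on (frame_dom e) (fun p => b p (tnth (e p) i) (tnth (e p) j)).

Definition smooth_bundle_map_to_TM (a : forall p, E p -> tangent p) : Prop :=
  forall e, frames e -> forall (i : 'I_r) f, smooth f ->
    smooth_on (frame_dom e) (fun p => a p (tnth (e p) i) f).

Definition is_subbundle (W : forall p, {vspace E p}) : Prop :=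
  forall p, exists k (U : set M) (s : forall q, k.-tuple (E q)),
    [/\ open U, U p,
        forall i : 'I_k, smooth_section_on U (fun q => tnth (s q) i) &
        forall q, U q -> basis_of (W q) (s q)].

End Bundles.

(* The bracket is a total operation on set-theoretic sections, constrained only
   on smooth ones. *)
Record courant_algebroid (R : realType) (n : nat) (M : manifold R n) (r : nat) :=
  CourantAlgebroid {
  ca_bundle :> vector_bundle M r;
  scalar : forall p, {symmetric ca_bundle p};
  scalar_smooth : smooth_form (fun p => scalar p);
  scalar_nondegenerate : forall p, nondegenerate (scalar p);
  anchor : forall p, ca_bundle p -> tangent p;
  anchor_linear : forall p (a : R) (u v : ca_bundle p) f, smooth f ->
    anchor (a *: u + v) f = a * anchor u f + anchor v f;
  anchor_smooth : smooth_bundle_map_to_TM anchor;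
  bracket : section ca_bundle -> section ca_bundle -> section ca_bundle;
  bracket_smooth : forall u v, smooth_section u -> smooth_section v ->
    smooth_section (bracket u v);
  bracket_linearl : forall (a : R) u v w,
    smooth_section u -> smooth_section v -> smooth_section w -> forall p,
    bracket (fun q => a *: u q + v q) w p = a *: bracket u w p + bracket v w p;
  bracket_linearr : forall (a : R) u v w,
    smooth_section u -> smooth_section v -> smooth_section w -> forall p,
    bracket w (fun q => a *: u q + v q) p = a *: bracket w u p + bracket w v p;
  bracket_jacobi : forall u v w,
    smooth_section u -> smooth_section v -> smooth_section w -> forall p,
    bracket u (bracket v w) p = bracket (bracket u v) w p + bracket v (bracket u w) p;
  bracket_leibniz : forall u v f,
    smooth_section u -> smooth_section v -> smooth f -> forall p,
    bracket u (fun q => f q *: v q) p = f p *: bracket u v p + anchor (u p) f *: v p;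
  bracket_metric : forall u v w,
    smooth_section u -> smooth_section v -> smooth_section w -> forall p,
    anchor (u p) (fun q => scalar q (v q) (w q)) =
      scalar p (bracket u v p) (w p) + scalar p (v p) (bracket u w p);
  bracket_sym : forall u v w,
    smooth_section u -> smooth_section v -> smooth_section w -> forall p,
    scalar p (bracket u v p + bracket v u p) (w p) =
      anchor (w p) (fun q => scalar q (u q) (v q))
}.

Definition has_signature (R : realType) (V : vectType R) (b : {symmetric V})
    (a c : nat) : Prop :=
  exists e : (a + c).-tuple V, basis_of fullv e /\
    forall i j, b (tnth e i) (tnth e j) =
      if i == j then (if (i < a)%N then 1 else -1) else 0.

Section GeneralizedGeometry.
Variables (R : realType) (n : nat) (M : manifold R n) (r : nat).
Variable E : courant_algebroid M r.

Definition odd_exact : Prop :=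
  (forall p (X : tangent p), exists u : E p, tangent_eq (anchor u) X) /\
  (forall p, has_signature (scalar E p) n.+1 n).

(* The complexified fibre is represented by pairs [(x, y)] standing for
   [x + i y]; [mul_i], [cendo] and [cbracket] are multiplication by [i] and the
   complex-linear extensions of endomorphisms and of the bracket. *)
Definition csection := forall p, (E p * E p)%type.
Definition re_part (z : csection) : section E := fun p => (z p).1.
Definition im_part (z : csection) : section E := fun p => (z p).2.

Definition smooth_csection (z : csection) : Prop :=
  smooth_section (re_part z) /\ smooth_section (im_part z).

Definition cbracket (z w : csection) : csection := fun p =>
  (bracket (re_part z) (re_part w) p - bracket (im_part z) (im_part w) p,
   bracket (re_part z) (im_part w) p + bracket (im_part z) (re_part w) p).

Definition mul_i (V : vectType R) (z : V * V) : V * V := (- z.2, z.1).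

Definition cendo (V : vectType R) (A : 'End(V)) (z : V * V) : V * V :=
  (A z.1, A z.2).

Definition in_i_eigenbundle (F : endo E) (z : csection) : Prop :=
  forall p, cendo (F p) (z p) = mul_i (z p).

Definition integrable (F : endo E) : Prop :=
  forall z w, smooth_csection z -> smooth_csection w ->
    in_i_eigenbundle F z -> in_i_eigenbundle F w ->
    in_i_eigenbundle F (cbracket z w).

Record Bn_almost_complex (F : endo E) : Prop := BnAlmostComplex {
  Bn_smooth : smooth_endo F;
  Bn_skew : forall p (u v : E p), scalar E p (F p u) v = - scalar E p u (F p v);
  Bn_rank : forall p, \dim (limg (F p)) = (2 * n)%N;
  Bn_square : exists u0 : section E,
    [/\ smooth_section u0,
        forall p, scalar E p (u0 p) (u0 p) = (-1) ^+ n &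
        forall p (v : E p),
          F p (F p v) = - v + ((-1) ^+ n * scalar E p v (u0 p)) *: u0 p]
}.

Record generalized_metric (Em : forall p, {vspace E p}) : Prop :=
  GeneralizedMetric {
  gm_subbundle : is_subbundle Em;
  gm_nondegenerate : forall p u, u \in Em p ->
    (forall v, v \in Em p -> scalar E p u v = 0) -> u = 0;
  gm_anchor_inj : forall p u v, u \in Em p -> v \in Em p ->
    tangent_eq (anchor u) (anchor v) -> u = v;
  gm_anchor_surj : forall p (X : tangent p),
    exists2 u, u \in Em p & tangent_eq (anchor u) X
}.

Definition Eplus (Em : forall p, {vspace E p}) (p : M) : {vspace E p} :=
  orthov (scalar E p) (Em p).

Definition Gend (Em : forall p, {vspace E p}) : endo E := fun p =>
  daddv_pi (Eplus Em p) (Em p) - daddv_pi (Em p) (Eplus Em p).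

Lemma GendE Em p : generalized_metric Em ->
  {in Eplus Em p, forall u, Gend Em p u = u} /\
  {in Em p, forall u, Gend Em p u = - u}.
Proof.
case=> _ nd _ _.
have I0 : (Em p :&: Eplus Em p = 0)%VS.
  apply/eqP; rewrite -subv0; apply/subvP => u; rewrite memv_cap memv0.
  by case/andP=> uE /mem_orthovP ou; apply/eqP/(nd p) => // v vE; apply: ou.
have I0' : (Eplus Em p :&: Em p = 0)%VS by rewrite capvC.
have sumE (U V : {vspace E p}) u : (U :&: V = 0)%VS -> u \in U ->
    daddv_pi U V u - daddv_pi V U u = u.
  move=> UV0 uU; have /eqP := daddv_pi_add UV0 (subvP (addvSl U V) _ uU).
  rewrite daddv_pi_id // addrC -subr_eq0 addrK => /eqP ->.
  by rewrite subr0.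
split=> u uE; rewrite /Gend add_lfunE opp_lfunE.
  exact: sumE.
by rewrite -opprB sumE.
Qed.

Definition gmetric (Em : forall p, {vspace E p}) (p : M) (u v : E p) : R :=
  scalar E p (Gend Em p u) v.

Record Bn_almost_pseudo_Hermitian (Em : forall p, {vspace E p}) (F : endo E)
    : Prop := BnAlmostPseudoHermitian {
  aph_metric : generalized_metric Em;
  aph_complex : Bn_almost_complex F;
  aph_comm : forall p, (Gend Em p \o F p = F p \o Gend Em p)%VF
}.

Definition pseudo_Hermitian_integrable (Em : forall p, {vspace E p})
    (F : endo E) : Prop :=
  integrable F /\ integrable (fun p => (Gend Em p \o F p)%VF).

(* [D u p w] is the value at [p] of [D_w u]; [D] is constrained only on smooth
   sections. *)
Definition connection_op := section E -> endo E.

Definition cov (D : connection_op) (w u : section E) : section E :=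
  fun p => D u p (w p).

Record generalized_connection (D : connection_op) : Prop :=
  GeneralizedConnection {
  gc_smooth : forall u, smooth_section u -> smooth_endo (D u);
  gc_linear : forall (a : R) u v, smooth_section u -> smooth_section v ->
    forall p, D (fun q => a *: u q + v q) p = a *: D u p + D v p;
  gc_leibniz : forall v u f,
    smooth_section v -> smooth_section u -> smooth f -> forall p,
    cov D v (fun q => f q *: u q) p = anchor (v p) f *: u p + f p *: cov D v u p;
  gc_metric : forall w u v,
    smooth_section w -> smooth_section u -> smooth_section v -> forall p,
    anchor (w p) (fun q => scalar E q (u q) (v q)) =
      scalar E p (cov D w u p) (v p) + scalar E p (u p) (cov D w v p)
}.

Definition torsion (D : connection_op) (u v w : section E) (p : M) : R :=
  scalar E p (cov D u v p - cov D v u p - bracket u v p) (w p)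
  + scalar E p (cov D w u p) (v p).

Definition torsion_free (D : connection_op) : Prop :=
  forall u v w, smooth_section u -> smooth_section v -> smooth_section w ->
    forall p, torsion D u v w p = 0.

Definition cov_form (D : connection_op) (b : forall p, E p -> E p -> R)
    (w u v : section E) (p : M) : R :=
  anchor (w p) (fun q => b q (u q) (v q))
  - b p (cov D w u p) (v p) - b p (u p) (cov D w v p).

Definition cov_endo (D : connection_op) (A : endo E) (w u : section E)
    : section E := fun p =>
  cov D w (fun q => A q (u q)) p - A p (cov D w u p).

Definition preserves_form (D : connection_op) (b : forall p, E p -> E p -> R)
    : Prop :=
  forall w u v, smooth_section w -> smooth_section u -> smooth_section v ->
    forall p, cov_form D b w u v p = 0.

Definition preserves_endo (D : connection_op) (A : endo E) : Prop :=
  forall w u, smooth_section w -> smooth_section u ->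
    forall p, cov_endo D A w u p = 0.

End GeneralizedGeometry.

(* Main.v *)
(* Let P = -F^2 be the projection onto the orthogonal complement of u0, let
   x+ and x- be the components of x in E+ and E-, and let a : E -> E- be the
   lift of the anchor to E-, with adjoint a*.  Since the anchor kills the image
   of a*, the map b = 1 - a* takes values in E+ and lifts the anchor as well, so
     D0_w u = [a w, u+]+ + [b w, u-]-
   is a generalized connection preserving G.  If F and G F are integrable, then
   comparing the two Nijenhuis identities on mixed pairs shows that D0 preserves
   F, and the torsion T of D0 satisfies
     T(x,y,z) = T(x,Fy,Fz) + T(Fx,y,Fz) + T(Fx,Fy,z),  T(u0,Fx,Fy) = T(u0,x,y)
   on the complement of u0.  These two identities make
     <S_w u, v> = T(Nw, Pu, Pv) + T(Nw, Fu, Fv),  N = -(P/4 + (1 - P)/2),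
   a correction preserving (G, F) such that D0 + S is torsion-free.  The converse
   reads the integrability of F and of G F off the vanishing torsion. *)
From HB Require Import structures.
Require Import Defs.
From mathcomp Require Import all_boot all_order all_algebra.
From mathcomp Require Import all_classical all_reals all_analysis.
From mathcomp Require Import ring lra.

Set Implicit Arguments.
Unset Strict Implicit.
Unset Printing Implicit Defensive.

Import Order.TTheory GRing.Theory Num.Theory.
Import numFieldNormedType.Exports.

Local Open Scope classical_set_scope.
Local Open Scope ring_scope.

(** * Connections on Courant-Dorfman algebras *)

(** Analysis enters only in the passage between bundles and sections. The construction itself is a
    computation in a module over the smooth functions, and the resulting operators return to the
    fibres by tensoriality. The obstacle is the odd direction. Since G^end commutes with F it
    preserves the line of u0, but the sign by which it acts there may vary between components of M,
    so u0 belongs to neither E+ nor E- globally. It is handled through the factor k with G^end u0 =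
    k u0 and k^2 = 1, which every vector field annihilates. D0 is tensorial in w because a w is
    orthogonal to E+ and b w to E-, which kills the derivative terms of the bracket. Its torsion has
    no component mixing E+ with E-; hence a correction built from T still preserves G. The constants
    in N come from the cyclic sum of S. On three arguments orthogonal to u0 it collects 3 T plus the
    three F-twisted terms, whose sum is again T: in all 4 T, hence 1/4. An argument along u0
    survives only in the slot of w, where the two summands of S agree: 2 T, hence 1/2. *)

(* A Courant algebroid seen through its sections: [A] stands for the ring of
   smooth functions, [G] for the module of smooth sections. *)
Record courant_dorfman (A : comPzRingType) (G : lmodType A) := CourantDorfman {
  cd_half : A;
  cd_ip : G -> G -> A;
  cd_an : G -> A -> A;
  cd_br : G -> G -> G;
  cd_halfE : cd_half + cd_half = 1;
  cd_ipC : forall x y, cd_ip x y = cd_ip y x;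
  cd_ipDl : forall x y z, cd_ip (x + y) z = cd_ip x z + cd_ip y z;
  cd_ipZl : forall f x z, cd_ip (f *: x) z = f * cd_ip x z;
  cd_nondeg : forall x, (forall z, cd_ip x z = 0) -> x = 0;
  cd_anDl : forall x y f, cd_an (x + y) f = cd_an x f + cd_an y f;
  cd_anZl : forall f x g, cd_an (f *: x) g = f * cd_an x g;
  cd_anD : forall x f g, cd_an x (f + g) = cd_an x f + cd_an x g;
  cd_anM : forall x f g, cd_an x (f * g) = cd_an x f * g + f * cd_an x g;
  cd_brDl : forall x y z, cd_br (x + y) z = cd_br x z + cd_br y z;
  cd_brDr : forall x y z, cd_br x (y + z) = cd_br x y + cd_br x z;
  cd_brZr : forall x f y, cd_br x (f *: y) = f *: cd_br x y + cd_an x f *: y;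
  cd_jacobi : forall x y z,
    cd_br x (cd_br y z) = cd_br (cd_br x y) z + cd_br y (cd_br x z);
  cd_metric : forall x y z,
    cd_an x (cd_ip y z) = cd_ip (cd_br x y) z + cd_ip y (cd_br x z);
  cd_sym : forall x y z,
    cd_ip (cd_br x y + cd_br y x) z = cd_an z (cd_ip x y)
}.

Section CourantDorfmanTheory.
Variables (A : comPzRingType) (G : lmodType A) (C : courant_dorfman G).
Implicit Types (x y z u v w : G) (f g : A).

Local Notation half := (cd_half C).
Local Notation "<| x , y |>" := (cd_ip C x y).
Local Notation an := (cd_an C).
Local Notation br := (cd_br C).

Lemma ipDr x y z : <|x, y + z|> = <|x, y|> + <|x, z|>.
Proof. by rewrite cd_ipC cd_ipDl !(cd_ipC C x). Qed.

Lemma ipZr x f z : <|x, f *: z|> = f * <|x, z|>.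
Proof. by rewrite cd_ipC cd_ipZl (cd_ipC C x). Qed.

Lemma ipNl x z : <|- x, z|> = - <|x, z|>.
Proof. by rewrite -scaleN1r cd_ipZl mulN1r. Qed.

Lemma ipNr x z : <|x, - z|> = - <|x, z|>.
Proof. by rewrite -scaleN1r ipZr mulN1r. Qed.

Lemma ip0l z : <|0, z|> = 0.
Proof. by rewrite -(scale0r 0) cd_ipZl mul0r. Qed.

Lemma ip0r z : <|z, 0|> = 0.
Proof. by rewrite cd_ipC ip0l. Qed.

Definition ipE := (cd_ipDl C, ipDr, cd_ipZl C, ipZr, ipNl, ipNr, ip0l, ip0r).

Lemma ip_inj x y : (forall z, <|x, z|> = <|y, z|>) -> x = y.
Proof.
move=> xy; apply/eqP; rewrite -subr_eq0; apply/eqP; apply: (cd_nondeg (c := C)).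
by move=> z; rewrite !ipE xy subrr.
Qed.

Lemma half2 f : f + f = 0 -> f = 0.
Proof. by move=> ff; rewrite -[f]mul1r -(cd_halfE C) mulrDl -mulrDr ff mulr0. Qed.

Lemma an0 x : an x 0 = 0.
Proof.
have := cd_anD C x 0 0; rewrite addr0 => /esym/eqP.
by rewrite -subr_eq0 addrK => /eqP.
Qed.

(** Lets [ring] finish a goal modulo known equations: the difference of its sides is written as a
    sum of differences that vanish. *)
Lemma lincomb2 f1 g1 f2 g2 h1 h2 : f1 = g1 -> f2 = g2 ->
  h1 - h2 = (f1 - g1) + (f2 - g2) -> h1 = h2.
Proof. by move=> -> -> /eqP; rewrite !subrr addr0 subr_eq0 => /eqP. Qed.

Lemma lincomb1 f1 g1 h1 h2 : f1 = g1 -> h1 - h2 = f1 - g1 -> h1 = h2.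
Proof. by move=> -> /eqP; rewrite !subrr subr_eq0 => /eqP. Qed.

Lemma anN x f : an x (- f) = - an x f.
Proof.
by apply/eqP; rewrite -subr_eq0 opprK -cd_anD addNr an0.
Qed.

Lemma an1 x : an x 1 = 0.
Proof.
have := cd_anM C x 1 1; rewrite !mul1r mulr1 => /eqP.
by rewrite -subr_eq0 opprD addrA subrr sub0r oppr_eq0 => /eqP.
Qed.

Lemma anNl x f : an (- x) f = - an x f.
Proof. by rewrite -scaleN1r cd_anZl mulN1r. Qed.

Lemma brNr x y : (br x (- y)) = - (br x y).
Proof. by rewrite -scaleN1r cd_brZr anN an1 oppr0 scale0r addr0 scaleN1r. Qed.

Lemma ip_brC x y z : <|br x y, z|> = an z <|x, y|> - <|br y x, z|>.
Proof. by rewrite -cd_sym cd_ipDl addrK. Qed.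

Lemma ip_br_swap x y z : <|br x y, z|> = an x <|y, z|> - <|br x z, y|>.
Proof. by rewrite cd_metric (cd_ipC C y) addrK. Qed.

(** The Leibniz rule concerns the second argument; [cd_sym] exchanges the arguments at the price of
    one derivative along [z]. *)
Lemma ip_brZl f x y z :
  <|br (f *: x) y, z|> = f * <|br x y, z|> - an y f * <|x, z|> + an z f * <|x, y|>.
Proof.
rewrite ip_brC cd_brZr !ipE cd_anM (ip_brC x y); ring.
Qed.

Lemma brNl x y : (br (- x) y) = - (br x y).
Proof.
apply: ip_inj => z; rewrite -scaleN1r ip_brZl anN an1 anN an1 !ipE; ring.
Qed.

Definition brE := (cd_brDl C, cd_brDr C, brNl, brNr).

(** The anchor respects brackets: expand the Jacobi identity on [x], [y], [f *: w]. The factor [w]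
    stays because scalars are not assumed to act faithfully; a unit vector removes it in
    [an_sym_br]. *)
Lemma an_br_comm x y f w :
  an (br x y) f *: w = (an x (an y f) - an y (an x f)) *: w.
Proof.
have jac := cd_jacobi C x y (f *: w); have jac' := cd_jacobi C x y w.
apply: ip_inj => z; move: (congr1 (fun t => <|t, z|>) jac).
rewrite !(cd_brZr, cd_brDr) jac' !ipE => e.
by apply: (lincomb1 (esym e)); ring.
Qed.

(* [u] is a unit vector up to sign; it makes the action of scalars faithful and
   exhibits every scalar as a product <|x, y|>. *)
Record unit_vector u (eps : A) : Prop := UnitVector {
  uv_const : forall x, an x eps = 0;
  uv_sqr : eps * eps = 1;
  uv_norm : <|u, u|> = eps
}.

Record almost_complex (F : G -> G) u (eps : A) : Prop := AlmostComplex {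
  ac_unit : unit_vector u eps;
  ac_D : forall x y, F (x + y) = F x + F y;
  ac_Z : forall f x, F (f *: x) = f *: F x;
  ac_skew : forall x y, <|F x, y|> = - <|x, F y|>;
  ac_sqr : forall x, F (F x) = - x + (eps * <|x, u|>) *: u
}.

(** Real form of the closure of the i-eigenbundle: for [x], [y] orthogonal to [u], this says that
    the bracket of x - iFx and y - iFy has the form v - iFv. *)
Definition closed_eigenbundle (F : G -> G) u : Prop :=
  forall x y, <|x, u|> = 0 -> <|y, u|> = 0 ->
  F ((br x y) - (br (F x) (F y))) = (br x (F y)) + (br (F x) y).

Section AlmostComplexTheory.
Variables (F : G -> G) (u : G) (eps : A).
Hypothesis acF : almost_complex F u eps.

Lemma acN x : F (- x) = - F x.
Proof. by rewrite -scaleN1r (ac_Z acF) scaleN1r. Qed.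

(** The square of [F] kills [u], yet it is -1 on [F u], which is orthogonal to [u] by skewness. *)
Lemma ac_u : F u = 0.
Proof.
have [[ec e2 uu] FD FZ sk sq] := acF.
have FFu : F (F u) = 0 by rewrite sq uu e2 scale1r addNr.
have h : <|F u, u|> = 0 by apply: half2; rewrite {1}sk cd_ipC addNr.
have F0 : F 0 = 0 by rewrite -[X in F X](scale0r u) FZ scale0r.
have := sq (F u); rewrite FFu F0 h mulr0 scale0r addr0 => /eqP.
by rewrite eq_sym oppr_eq0 => /eqP.
Qed.

Lemma ac_ip x : <|F x, u|> = 0.
Proof. by rewrite (ac_skew acF) ac_u ip0r oppr0. Qed.

Lemma ac_ip' x : <|u, F x|> = 0.
Proof. by rewrite cd_ipC ac_ip. Qed.

Lemma ac_sqr_perp x : <|x, u|> = 0 -> F (F x) = - x.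
Proof. by move=> xu; rewrite (ac_sqr acF) xu mulr0 scale0r addr0. Qed.

(* Locked, since rewriting with linearity would otherwise see the sum behind
   [perp]. *)
Definition proj_u x := locked ((eps * <|x, u|>) *: u).
Definition perp x := locked (x - proj_u x).

Lemma proj_uE x : proj_u x = (eps * <|x, u|>) *: u.
Proof. by rewrite /proj_u -lock. Qed.

Lemma perpE x : perp x = x - proj_u x.
Proof. by rewrite /perp -lock. Qed.

Lemma perp_ip x : <|perp x, u|> = 0.
Proof.
have [[ec e2 uu] _ _ _ _] := acF.
by rewrite perpE proj_uE !ipE uu -mulrA [_ * eps]mulrC mulrA e2 mul1r subrr.
Qed.

Lemma perp_proj x : x = perp x + proj_u x.
Proof. by rewrite perpE subrK. Qed.

Lemma ac_perp x : F (perp x) = F x.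
Proof.
by rewrite perpE proj_uE (ac_D acF) acN (ac_Z acF) ac_u scaler0 subr0.
Qed.

Lemma ac_proj x : F (proj_u x) = 0.
Proof. by rewrite proj_uE (ac_Z acF) ac_u scaler0. Qed.

Lemma br_uu z : <|br u u, z|> = 0.
Proof.
have [[ec e2 uu] _ _ _ _] := acF.
by apply: half2; rewrite -cd_ipDl cd_sym uu ec.
Qed.

Hypothesis intF : closed_eigenbundle F u.

Lemma br_perp_u x y : <|x, u|> = 0 -> <|y, u|> = 0 ->
  <|br x (F y), u|> + <|br (F x) y, u|> = 0.
Proof. by move=> xu yu; rewrite -cd_ipDl -intF// ac_ip. Qed.

(** On the complement of [u], <[u, y], z> equals <[y, z], u>, so this is the [u]-component of
    integrability, [br_perp_u], read as an operator identity. *)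
Lemma br_u_ac x : <|x, u|> = 0 -> (br u (F x)) = F (br u x).
Proof.
move=> xu.
have bu y z : <|y, u|> = 0 -> <|z, u|> = 0 -> <|br u y, z|> = <|br y z, u|>.
  move=> yu zu; rewrite ip_brC (cd_ipC C u) yu an0 ip_br_swap (cd_ipC C u) zu an0.
  ring.
apply: ip_inj => z; rewrite (perp_proj z) ipDr [RHS]ipDr; congr (_ + _).
  rewrite bu ?ac_ip ?perp_ip// (ac_skew acF) bu ?ac_ip//.
  by apply/eqP; rewrite -addr_eq0 addrC br_perp_u ?perp_ip.
by rewrite proj_uE !ipZr ac_ip ip_br_swap ac_ip an0 br_uu subrr.
Qed.

End AlmostComplexTheory.

(** [K] models G^end: its eigenspaces for 1 and -1 are the sections of E+ and E-. Replacing [K] by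
    its opposite exchanges the two, so each argument is made for one sign only. *)
Record involution (K : G -> G) : Prop := Involution {
  inv_D : forall x y, K (x + y) = K x + K y;
  inv_Z : forall f x, K (f *: x) = f *: K x;
  inv_sym : forall x y, <|K x, y|> = <|x, K y|>;
  inv_K : forall x, K (K x) = x
}.

Lemma invN K x : involution K -> K (- x) = - K x.
Proof. by move=> iK; rewrite -scaleN1r (inv_Z iK) scaleN1r. Qed.

Lemma involution_opp K : involution K -> involution (fun x => - K x).
Proof.
move=> iK; have [KD KZ Ks KK] := iK; split.
- by move=> x y; rewrite KD opprD.
- by move=> f x; rewrite KZ scalerN.
- by move=> x y; rewrite !ipE Ks.
- by move=> x; rewrite invN// opprK.
Qed.

Lemma ip_eigen K x y : involution K -> K x = - x -> K y = y -> <|x, y|> = 0.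
Proof.
move=> iK Kx Ky; apply: half2; rewrite -{1}Ky -(inv_sym iK) Kx ipNl.
by rewrite addNr.
Qed.

(** Both derivatives of [f] are multiplied by pairings of opposite eigenvectors. This makes each
    half of the base connection tensorial in its direction. *)
Lemma br_tensorial K f x y z : involution K -> K x = - x -> K y = y -> K z = z ->
  <|br (f *: x) y, z|> = f * <|br x y, z|>.
Proof.
move=> iK Kx Ky Kz; rewrite ip_brZl (ip_eigen iK Kx Ky) (ip_eigen iK Kx Kz).
ring.
Qed.

Lemma almost_complex_involution F u eps K : almost_complex F u eps ->
  involution K -> (forall x, K (F x) = F (K x)) ->
  almost_complex (fun x => K (F x)) u eps.
Proof.
move=> acF iK KF; have [uu FD FZ Fs FF] := acF; have [KD KZ Ks KK] := iK; split => //.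
- by move=> x y; rewrite FD KD.
- by move=> f x; rewrite FZ KZ.
- by move=> x y; rewrite Ks Fs KF.
- by move=> x; rewrite -KF KK FF.
Qed.

(** * Brackets of sections of E- with sections of E+ *)

Section Mixed.
Variables (F : G -> G) (u : G) (eps : A) (K : G -> G).
Hypothesis acF : almost_complex F u eps.
Hypothesis iK : involution K.
Hypothesis KF : forall x, K (F x) = F (K x).

Local Notation k := (eps * <|K u, u|>).
Local Notation Q := (proj_u u eps).
Local Notation P := (perp u eps).

(** [K u] lies in the kernel of [F], and the formula for the square of [F] shows that this kernel is
    spanned by [u]. *)
Lemma inv_u : K u = k *: u.
Proof.
have F0 : F 0 = 0 by rewrite -[X in F X](scale0r u) (ac_Z acF) scale0r.
have := ac_sqr acF (K u); rewrite -KF (ac_u acF) -[X in K X](scale0r u) (inv_Z iK).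
rewrite scale0r F0 => /eqP.
by rewrite eq_sym addrC subr_eq0 => /eqP.
Qed.

Lemma inv_k2 : k * k = 1.
Proof.
have [[ec e2 uu] _ _ _ _] := acF.
have e : k *: (k *: u) = u.
  by rewrite -[X in _ *: X]inv_u -(inv_Z iK) -inv_u (inv_K iK).
have := congr1 (fun t => eps * <|t, u|>) e; rewrite !cd_ipZl uu => e'.
rewrite -[RHS]e2 -e'.
apply: (lincomb1 (f1 := - k * k * (eps * eps)) (g1 := - k * k)); last by ring.
by rewrite e2 mulr1.
Qed.

Lemma an_k x : an x k = 0.
Proof.
have := congr1 (an x) inv_k2; rewrite an1 cd_anM => e.
have : an x k * k = 0 by apply: half2; rewrite -[RHS]e; ring.
by move=> e'; rewrite -[LHS]mulr1 -inv_k2 mulrA e' mul0r.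
Qed.

Lemma ip_inv_u x : <|K x, u|> = k * <|x, u|>.
Proof. by rewrite (inv_sym iK) -ipZr -inv_u. Qed.

Lemma inv_proj x : K (Q x) = Q (K x).
Proof.
rewrite !proj_uE (inv_Z iK) ip_inv_u.
transitivity ((eps * <|x, u|>) *: (k *: u)); first by congr (_ *: _); exact: inv_u.
by rewrite scalerA; congr (_ *: _); ring.
Qed.

Lemma inv_perp x : K (P x) = P (K x).
Proof. by rewrite !perpE (inv_D iK) invN// inv_proj. Qed.

Lemma inv_kx x : K x = - x -> k * <|x, u|> = - <|x, u|>.
Proof. by move=> Kx; rewrite -ip_inv_u Kx ipNl. Qed.

Lemma inv_kz x : K x = x -> k * <|x, u|> = <|x, u|>.
Proof. by move=> Kx; rewrite -ip_inv_u Kx. Qed.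

(* [u] lies in one eigenbundle of [K] on each connected component, so the
   coefficients of [x] and [z] along [u] have disjoint supports. *)
Lemma an_disjoint w x z : K x = - x -> K z = z ->
  an w (eps * <|x, u|>) * <|u, z|> = 0.
Proof.
have [[ec e2 uu] _ _ _ _] := acF.
move=> Kx Kz; rewrite cd_anM ec mul0r add0r (cd_ipC C u).
have e : k * an w <|x, u|> = - an w <|x, u|>.
  by rewrite -anN -(inv_kx Kx) cd_anM an_k mul0r add0r.
apply: half2; rewrite -{1}(inv_kz Kz) [_ * (k * _)]mulrA.
have -> : eps * an w <|x, u|> * k = - (eps * an w <|x, u|>).
  by rewrite -mulrN -e; ring.
by rewrite mulNr addNr.
Qed.

Hypothesis intF : closed_eigenbundle F u.
Hypothesis intKF : closed_eigenbundle (fun x => K (F x)) u.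

(** Paired with [z], the closure identities of [F] and of [K] after [F] differ only by the sign of
    the terms in [F x], because [F x] is again a -1 eigenvector. Adding them removes these terms. *)
Lemma mixed_perp x y z : K x = - x -> K y = y -> K z = z ->
  <|x, u|> = 0 -> <|y, u|> = 0 -> <|br x (F y), z|> = - <|br x y, F z|>.
Proof.
move=> Kx Ky Kz xu yu.
have /(congr1 (fun t => <|t, z|>)) := intF xu yu.
have /(congr1 (fun t => <|t, z|>)) := intKF xu yu.
rewrite (inv_sym iK) Kz !(ac_skew acF) !KF Kx Ky !(acN acF) !brE !ipE opprK.
move=> e1 e2; apply/eqP; rewrite -subr_eq0; apply/eqP; apply: half2.
by apply: (lincomb2 (esym e1) (esym e2)); ring.
Qed.

Lemma mixed x y z : K x = - x -> K y = y -> K z = z ->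
  <|br x (F y), z|> = - <|br x y, F z|>.
Proof.
have [[ec e2 uu] _ _ _ _] := acF.
move=> Kx Ky Kz.
have KP v : K v = v -> K (P v) = P v by move=> Kv; rewrite inv_perp Kv.
have KQ v : K v = v -> K (Q v) = Q v by move=> Kv; rewrite inv_proj Kv.
have PN v : P (- v) = - P v.
  by rewrite !perpE !proj_uE ipNl mulrN scaleNr opprD.
have QN v : Q (- v) = - Q v by rewrite !proj_uE ipNl mulrN scaleNr.
have KPx : K (P x) = - P x by rewrite inv_perp Kx PN.
have KQx : K (Q x) = - Q x by rewrite inv_proj Kx QN.
rewrite (perp_proj u eps x) !cd_brDl ![in RHS]ipE [in LHS]cd_ipDl opprD; congr (_ + _).
  rewrite -(ac_perp acF y) (mixed_perp KPx (KP _ Ky) Kz) ?(perp_ip acF)//.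
  congr (- _); rewrite [in RHS](perp_proj u eps y) cd_brDr cd_ipDl.
  (* The part of [y] along [u] contributes nothing: invariance of the pairing moves it to the last
     slot, where the orthogonal case places [F] in front of it. *)
  rewrite [X in _ = _ + X](_ : _ = 0) ?addr0//.
  rewrite ip_br_swap {1}proj_uE cd_ipZl (ac_ip' acF) mulr0 an0 sub0r.
  rewrite -(ac_perp acF z) (mixed_perp KPx (KP _ Kz) (KQ _ Ky)) ?(perp_ip acF)//.
  by rewrite (ac_proj acF) ipE !oppr0.
(* The part of [x] along [u] is a variable multiple of [u]. The derivatives of its coefficient die
   by [an_disjoint] or because [F] is orthogonal to [u], and [br_u_ac] treats the bracket with [u]
   itself. *)
rewrite !(proj_uE u eps x) !ip_brZl (cd_ipC C u (F _)) (cd_ipC C u (F _)) !(ac_ip acF).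
rewrite [an (F y) _ * _]an_disjoint// [an (F z) _ * _]an_disjoint//.
rewrite !mulr0 !subr0 !addr0 -mulrN; congr (_ * _).
rewrite -(ac_perp acF y) (br_u_ac acF intF) ?(perp_ip acF)// (ac_skew acF).
congr (- _); rewrite [in RHS](perp_proj u eps y) cd_brDr cd_ipDl.
rewrite [X in _ = _ + X](_ : _ = 0) ?addr0//.
rewrite ip_br_swap {1}proj_uE cd_ipZl (ac_ip' acF) mulr0 an0 sub0r.
rewrite -(ac_perp acF z) (br_u_ac acF intF) ?(perp_ip acF)// (ac_skew acF).
by rewrite (ac_proj acF) ipE !oppr0.
Qed.

End Mixed.

(** * Connections, torsion, and integrability in terms of torsion *)

Record connection (D : G -> G -> G) : Prop := Connection {
  con_Dl : forall w w' x, D (w + w') x = D w x + D w' x;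
  con_Zl : forall f w x, D (f *: w) x = f *: D w x;
  con_Dr : forall w x y, D w (x + y) = D w x + D w y;
  con_Zr : forall w f x, D w (f *: x) = an w f *: x + f *: D w x;
  con_metric : forall w x y, an w <|x, y|> = <|D w x, y|> + <|x, D w y|>
}.

Definition tor (D : G -> G -> G) x y z : A :=
  <|D x y - D y x - br x y, z|> + <|D z x, y|>.

Definition parallel (D : G -> G -> G) (F : G -> G) : Prop :=
  forall w x, D w (F x) = F (D w x).

Section Torsion.
Variable D : G -> G -> G.
Hypothesis cD : connection D.
Local Notation T := (tor D).

(** The term <D_z x, y> of the torsion compensates the symmetric part of the Dorfman bracket, both
    being governed by the derivative of <x, y> along [z]. *)
Lemma tor_skewl x y z : T x y z = - T y x z.
Proof.
rewrite /tor !ipE (ip_brC y x).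
apply: (lincomb1 (esym (con_metric cD z x y))); rewrite (cd_ipC C x (D z y)) (cd_ipC C y x); ring.
Qed.

Lemma tor_skewr x y z : T x y z = - T x z y.
Proof.
rewrite /tor !ipE (ip_br_swap x z).
apply: (lincomb1 (esym (con_metric cD x y z))).
rewrite (cd_ipC C y (D x z)) (cd_ipC C z y); ring.
Qed.

Lemma tor_cycle x y z : T x y z = T y z x.
Proof. by rewrite tor_skewl tor_skewr opprK. Qed.

Lemma tor_diag x z : T x x z = 0.
Proof. by apply: half2; rewrite {1}tor_skewl addNr. Qed.

Lemma torDr x y z z' : T x y (z + z') = T x y z + T x y z'.
Proof. by rewrite /tor (con_Dl cD) !ipE; ring. Qed.

Lemma torZr f x y z : T x y (f *: z) = f * T x y z.
Proof. by rewrite /tor (con_Zl cD) !ipE; ring. Qed.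

Lemma torDm x y y' z : T x (y + y') z = T x y z + T x y' z.
Proof. by rewrite tor_skewr torDr opprD -!tor_skewr. Qed.

Lemma torZm f x y z : T x (f *: y) z = f * T x y z.
Proof. by rewrite tor_skewr torZr -mulrN -tor_skewr. Qed.

Lemma torDl x x' y z : T (x + x') y z = T x y z + T x' y z.
Proof. by rewrite !(tor_skewl _ y) torDm opprD. Qed.

Lemma torZl f x y z : T (f *: x) y z = f * T x y z.
Proof. by rewrite !(tor_skewl _ y) torZm mulrN. Qed.

Lemma torNl x y z : T (- x) y z = - T x y z.
Proof. by rewrite -scaleN1r torZl mulN1r. Qed.

Lemma torNm x y z : T x (- y) z = - T x y z.
Proof. by rewrite -scaleN1r torZm mulN1r. Qed.

Lemma torNr x y z : T x y (- z) = - T x y z.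
Proof. by rewrite -scaleN1r torZr mulN1r. Qed.

Definition torE := (torDl, torDm, torDr, torZl, torZm, torZr, torNl, torNm, torNr).

Variables (F : G -> G) (u : G) (eps : A).
Hypothesis acF : almost_complex F u eps.
Hypothesis DF : parallel D F.

Lemma ac_ipFF x y : <|y, u|> = 0 -> <|F x, F y|> = <|x, y|>.
Proof. by move=> yu; rewrite (ac_skew acF) (ac_sqr_perp acF) // ipNr opprK. Qed.

(** Such an [x] is in the image of [F], which [D] preserves and which is orthogonal to [u]. *)
Lemma con_perp w x : <|x, u|> = 0 -> <|D w x, u|> = 0.
Proof.
move=> xu; rewrite -[x]opprK -(ac_sqr_perp acF xu) -(acN acF) !DF.
exact: ac_ip acF _.
Qed.

(** Without torsion the bracket is an expression in [D]; as [F] commutes with [D], closure becomes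
    an algebraic identity on the complement of [u]. *)
Lemma torsion_free_closed : (forall x y z, T x y z = 0) -> closed_eigenbundle F u.
Proof.
move=> T0 x y xu yu; apply: ip_inj => z.
have brT x' y' z' : <|br x' y', z'|> =
    <|D x' y', z'|> - <|D y' x', z'|> + <|D z' x', y'|>.
  by apply: (lincomb1 (esym (T0 x' y' z'))); rewrite /tor !ipE; ring.
rewrite (ac_skew acF) !ipE !brT !DF.
rewrite (ac_ipFF _ yu) !(ac_skew acF) !(ac_sqr acF) !ipE.
rewrite !(con_perp _ xu) !(con_perp _ yu).
ring.
Qed.

Hypothesis intF : closed_eigenbundle F u.

(** This is closure paired with [F z]: since [D] commutes with [F], the terms in [D] cancel and the
    torsions keep only the brackets. *)
Lemma tor_perp x y z : <|x, u|> = 0 -> <|y, u|> = 0 -> <|z, u|> = 0 ->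
  T x y z = T x (F y) (F z) + T (F x) y (F z) + T (F x) (F y) z.
Proof.
move=> xu yu zu; have /(congr1 (fun t => <|t, F z|>)) := intF xu yu.
rewrite (ac_ipFF _ zu) => e; apply: (lincomb1 (esym e)).
rewrite /tor !ipE !DF !(ac_ipFF _ zu) !(ac_ipFF _ yu) !(ac_skew acF); ring.
Qed.

Lemma tor_unit x y : <|x, u|> = 0 -> <|y, u|> = 0 -> T (F x) (F y) u = T x y u.
Proof.
move=> xu yu.
have e : <|br x y - br (F x) (F y), u|> = 0.
  have yu' := ac_ip acF y; have := br_perp_u acF intF xu yu'.
  rewrite (ac_sqr_perp acF yu) brE !ipE => e; apply: (lincomb1 (esym e)).
  by rewrite ?ipE; ring.
apply: (lincomb1 e); rewrite /tor !ipE !DF !(ac_ip acF) (ac_ipFF _ yu).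
by rewrite !con_perp//; ring.
Qed.

End Torsion.

(** * Correcting a connection by its torsion *)

Section Correction.
Variables (D : G -> G -> G) (F K : G -> G) (u : G) (eps : A) (tau : G -> G -> G).
Hypothesis cD : connection D.
Hypothesis acF : almost_complex F u eps.
Hypothesis iK : involution K.
Hypothesis KF : forall x, K (F x) = F (K x).
Hypothesis DF : parallel D F.
Hypothesis DK : parallel D K.
Hypothesis intF : closed_eigenbundle F u.
Hypothesis tauE : forall x y z, <|tau x y, z|> = tor D x y z.
Hypothesis torK : forall x y z, tor D x (K y) z = tor D x y (K z).
Local Notation T := (tor D).
Local Notation Q := (proj_u u eps).
Local Notation P := (perp u eps).

(** [S] must be section-valued, so the torsion enters through [tau], which represents it for the
    pairing. Operators given by defining equations stay folded under rewriting. *)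
Variables (N : G -> G) (S D' : G -> G -> G).
Hypothesis NE : forall w, N w = - (half * half) *: P w - half *: Q w.
Hypothesis SE : forall w x, S w x = P (tau (N w) (P x)) - F (tau (N w) (F x)).
Hypothesis D'E : forall w x, D' w x = D w x + S w x.

Lemma perp_sym x y : <|P x, y|> = <|x, P y|>.
Proof. by rewrite !perpE !proj_uE !ipE (cd_ipC C u); ring. Qed.

Lemma perpD x y : P (x + y) = P x + P y.
Proof. by apply: ip_inj => z; rewrite !ipE !perp_sym !ipE. Qed.

Lemma perpZ f x : P (f *: x) = f *: P x.
Proof. by apply: ip_inj => z; rewrite !ipE !perp_sym !ipE. Qed.

Let ipS w x y : <|S w x, y|> = T (N w) (P x) (P y) + T (N w) (F x) (F y).
Proof. by rewrite SE !ipE perp_sym (ac_skew acF) !tauE opprK. Qed.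

Let ND w w' : N (w + w') = N w + N w'.
Proof.
apply: ip_inj => z; rewrite !NE !proj_uE perpD !ipE; ring.
Qed.

Let NZ f w : N (f *: w) = f *: N w.
Proof.
apply: ip_inj => z; rewrite !NE !proj_uE perpZ !ipE; ring.
Qed.

Lemma connection_corrected : connection D'.
Proof.
have [Dl Zl Dr Zr me] := cD; split.
- move=> w w' x; apply: ip_inj => z.
  by rewrite !D'E !ipE !ipS Dl ND !(torE cD) !ipE; ring.
- move=> f w x; apply: ip_inj => z.
  by rewrite !D'E !ipE !ipS Zl NZ !(torE cD) !ipE; ring.
- move=> w x y; apply: ip_inj => z.
  by rewrite !D'E !ipE !ipS Dr (ac_D acF) perpD !(torE cD) !ipE; ring.
- move=> w f x; apply: ip_inj => z.
  by rewrite !D'E !ipE !ipS Zr (ac_Z acF) perpZ !(torE cD) !ipE; ring.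
- move=> w x y; rewrite !D'E !ipE (cd_ipC C x (S w y)) !ipS me.
  rewrite (tor_skewr cD _ (P y)) (tor_skewr cD _ (F y)); ring.
Qed.

(** Up to sign, [F] exchanges the (P, P) and (F, F) summands of [S], because its square is -P; so
    each S_w commutes with [F]. *)
Lemma parallel_corrected_F : parallel D' F.
Proof.
move=> w x; apply: ip_inj => z; rewrite !D'E (ac_D acF) DF !ipE; congr (_ + _).
rewrite (ac_skew acF) !ipS.
have PF y : P (F y) = F y by rewrite perpE proj_uE (ac_ip acF) mulr0 scale0r subr0.
have FF y : F (F y) = - P y.
  by rewrite -(ac_perp acF y) (ac_sqr_perp acF) ?(perp_ip acF).
by rewrite !PF !FF !(torE cD); ring.
Qed.

(** [K] commutes with [P] and [F], and [torK] lets it slide between the last two slots of the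
    torsion. *)
Lemma parallel_corrected_K : parallel D' K.
Proof.
move=> w x; apply: ip_inj => z; rewrite !D'E (inv_D iK) DK !ipE; congr (_ + _).
rewrite (inv_sym iK) !ipS -!KF -!(inv_perp acF iK KF).
by rewrite !torK.
Qed.

Lemma torsion_free_corrected x y z : tor D' x y z = 0.
Proof.
have TS : tor D' x y z = T x y z + <|S x y, z|> - <|S y x, z|> + <|S z x, y|>.
  by rewrite /tor !D'E !ipE; ring.
have TQ v x' y' : <|x', u|> = 0 -> <|y', u|> = 0 -> T (Q v) (F x') (F y') = T (Q v) x' y'.
  move=> xu yu; rewrite proj_uE !(torE cD) (tor_cycle cD u) (tor_cycle cD u x').
  by rewrite (tor_unit acF DF intF).
have TP v x' y' : T (P v) (F (P x')) (F (P y')) = T (P v) (F x') (F y').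
  by rewrite !(ac_perp acF).
have ipSE v x' y' : <|S v x', y'|> = - (half * half) *
    (T (P v) (P x') (P y') + T (P v) (F (P x')) (F (P y'))) - T (Q v) (P x') (P y').
  rewrite ipS NE !(torE cD) -(ac_perp acF x') -(ac_perp acF y').
  rewrite TQ ?(perp_ip acF)//.
  apply: (lincomb1 (congr1 (fun h => - h * T (Q v) (P x') (P y')) (cd_halfE C))).
  ring.
rewrite TS !ipSE.
have px := perp_ip acF x; have py := perp_ip acF y; have pz := perp_ip acF z.
have TT := tor_perp acF DF intF px py pz.
(* Two arguments along [u] are proportional, so only components with at most one such argument
   survive. *)
have QQ v v' w : T (Q v) (Q v') w = 0.
  by rewrite !proj_uE !(torE cD) (tor_diag cD) !mulr0.
have TE : T x y z = T (P x) (P y) (P z) + T (Q x) (P y) (P z)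
    + T (P x) (Q y) (P z) + T (P x) (P y) (Q z).
  rewrite {1}(perp_proj u eps x) {1}(perp_proj u eps y) {1}(perp_proj u eps z).
  rewrite !(torE cD) !QQ (tor_cycle cD (P x) (Q y) (Q z)) QQ.
  by rewrite -(tor_cycle cD (Q z) (Q x)) QQ; ring.
have h4 : half * half + half * half + (half * half + half * half) = 1.
  by rewrite -[RHS]mulr1 -(cd_halfE C); ring.
rewrite TE (tor_skewl cD (P y) (P x)) (tor_skewl cD (P y) (F _)) (tor_skewl cD (Q y)).
rewrite (tor_cycle cD (P z) (P x)) (tor_cycle cD (P z) (F _)) (tor_cycle cD (Q z)).
move: TT; set t := T (P x) (P y) (P z).
set t1 := T (P x) (F _) (F _); set t2 := T (F _) (P _) (F _); set t3 := T (F _) (F _) _.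
move=> TT.
apply: (lincomb2 (congr1 (fun h => - t * h) h4) (congr1 (fun t => (half * half) * t) TT)).
ring.
Qed.

End Correction.

(** * The base connection built from the lifts [a] and [b] of the anchor *)

Section BaseConnection.
Variables (F K a a' : G -> G) (u : G) (eps : A).
Hypothesis acF : almost_complex F u eps.
Hypothesis iK : involution K.
Hypothesis KF : forall x, K (F x) = F (K x).
Hypothesis intF : closed_eigenbundle F u.
Hypothesis intKF : closed_eigenbundle (fun x => K (F x)) u.
Hypothesis aD : forall x y, a (x + y) = a x + a y.
Hypothesis aZ : forall f x, a (f *: x) = f *: a x.
Hypothesis a_adj : forall x y, <|a x, y|> = <|x, a' y|>.
Hypothesis Ka : forall x, K (a x) = - a x.
Hypothesis a_id : forall x, K x = - x -> a x = x.
Hypothesis an_a : forall x f, an (a x) f = an x f.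
Hypothesis an_inj : forall x, (forall f, an x f = 0) -> a x = 0.

Definition eproj (L : G -> G) x := locked (half *: (x + L x)).

Lemma eprojE L x : eproj L x = half *: (x + L x).
Proof. by rewrite /eproj -lock. Qed.

Local Notation K' := (fun x => - K x).
Local Notation pp := (eproj K).
Local Notation pm := (eproj K').

Lemma eproj_sum x : x = pp x + pm x.
Proof.
apply: ip_inj => z; rewrite !eprojE !ipE.
by apply: (lincomb1 (congr1 (fun h => - (h * <|x, z|>)) (cd_halfE C))); ring.
Qed.

Lemma eproj_fix L x : involution L -> L (eproj L x) = eproj L x.
Proof.
by move=> iL; rewrite eprojE (inv_Z iL) (inv_D iL) (inv_K iL) addrC.
Qed.

Lemma eproj_id L x : L x = x -> eproj L x = x.
Proof. by move=> Lx; rewrite eprojE Lx scalerDr -scalerDl cd_halfE scale1r. Qed.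

Lemma eproj_sym L x y : involution L -> <|eproj L x, y|> = <|x, eproj L y|>.
Proof. by move=> iL; rewrite !eprojE !ipE (inv_sym iL). Qed.

Lemma eprojD L x y : involution L -> eproj L (x + y) = eproj L x + eproj L y.
Proof. by move=> iL; apply: ip_inj => z; rewrite !ipE !eproj_sym// !ipE. Qed.

Lemma eprojZ L f x : involution L -> eproj L (f *: x) = f *: eproj L x.
Proof. by move=> iL; apply: ip_inj => z; rewrite !ipE !eproj_sym// !ipE. Qed.

Let iK' : involution K'. Proof. exact: involution_opp. Qed.

Lemma pm_eq x : K x = - x -> pm x = x.
Proof. by move=> Kx; rewrite eproj_id// Kx opprK. Qed.

Lemma K_pm x : K (pm x) = - pm x.
Proof. by rewrite -{2}(eproj_fix _ iK') opprK. Qed.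

Lemma K_pp x : K (pp x) = pp x.
Proof. exact: eproj_fix. Qed.

Lemma adj_fix x : K x = x -> a' x = 0.
Proof.
move=> Kx; apply: ip_inj => z; rewrite cd_ipC -a_adj ip0l.
exact: (ip_eigen iK).
Qed.

Variable b : G -> G.
Hypothesis bE : forall x, b x = x - a' x.

(** [b x] is orthogonal to the -1 eigenspace, since [a] fixes that eigenspace and [b] is adjoint to
    1 - a. *)
Lemma K_b x : K (b x) = b x.
Proof.
apply: ip_inj => z; rewrite (inv_sym iK) {1}[z](eproj_sum z) (inv_D iK) K_pp K_pm.
rewrite [in RHS](eproj_sum z) !ipDr; congr (_ + _).
rewrite !bE !ipE (cd_ipC C (a' _)) -a_adj a_id ?K_pm// (cd_ipC C x); ring.
Qed.

Lemma b_id x : K x = x -> b x = x.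
Proof. by move=> Kx; rewrite !bE adj_fix// subr0. Qed.

(** The anchor sends the bracket to the commutator of derivations, which is antisymmetric. *)
Lemma an_sym_br x y f : an (br x y + br y x) f = 0.
Proof.
have [[ec e2 uu] _ _ _ _] := acF.
have e : an (br x y + br y x) f *: u = 0.
  by rewrite cd_anDl scalerDl !an_br_comm -scalerDl addrC -opprB addNr scale0r.
have := congr1 (fun t => eps * <|t, u|>) e.
by rewrite cd_ipZl ip0l uu mulr0 mulrCA e2 mulr1.
Qed.

(* [a] kills [x, y] + [y, x], and pairing the latter with [a' z] is
   differentiating <x, y> along [a' z]. *)
Lemma an_adj y f : an (a' y) f = 0.
Proof.
have [[ec e2 uu] _ _ _ _] := acF.
have -> : f = <|(f * eps) *: u, u|> by rewrite cd_ipZl uu -mulrA e2 mulr1.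
rewrite -cd_sym cd_ipC (cd_ipC C (a' y)) -a_adj an_inj ?ip0l// => g.
exact: an_sym_br.
Qed.

Lemma an_b x f : an (b x) f = an x f.
Proof. by rewrite !bE cd_anDl anNl an_adj subr0. Qed.

Variable D0 : G -> G -> G.
Hypothesis D0E : forall w x, D0 w x = pp (br (a w) (pp x)) + pm (br (b w) (pm x)).

Lemma ip_eproj x y : <|x, y|> = <|pp x, pp y|> + <|pm x, pm y|>.
Proof.
rewrite {1}(eproj_sum x) {1}(eproj_sum y) !ipE.
by rewrite (cd_ipC C (pp x) (pm y)) !(ip_eigen iK (K_pm _) (K_pp _)) addr0 add0r.
Qed.

Let ipD0 w x z : <|D0 w x, z|> =
  <|br (a w) (pp x), pp z|> + <|br (b w) (pm x), pm z|>.
Proof. by rewrite D0E !ipE !eproj_sym. Qed.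

Let bD x y : b (x + y) = b x + b y.
Proof.
apply: ip_inj => z; rewrite !bE !ipE !(cd_ipC C (a' _)) -!a_adj !ipE; ring.
Qed.

Let bZ f x : b (f *: x) = f *: b x.
Proof.
apply: ip_inj => z; rewrite !bE !ipE !(cd_ipC C (a' _)) -!a_adj !ipE; ring.
Qed.

Lemma connection_base : connection D0.
Proof.
split.
- move=> w w' x; apply: ip_inj => z.
  by rewrite !ipE !ipD0 aD bD !brE !ipE; ring.
- move=> f w x; apply: ip_inj => z; rewrite !ipE !ipD0 aZ bZ.
  (* [a w] and [b w] lie in the eigenspace opposite to that of the section being differentiated. *)
  rewrite (br_tensorial _ iK (Ka _)) ?K_pp//.
  by rewrite (br_tensorial _ iK') ?K_pm ?K_b ?opprK//; ring.
- move=> w x y; apply: ip_inj => z.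
  by rewrite !ipE !ipD0 !eprojD// !brE !ipE; ring.
- move=> w f x; apply: ip_inj => z; rewrite !ipE !ipD0 !eprojZ// !cd_brZr !ipE.
  by rewrite an_a an_b (ip_eproj x z); ring.
- move=> w x y; rewrite (cd_ipC C x (D0 w y)) !ipD0.
  rewrite ip_eproj cd_anD -(an_a w <|pp x, pp y|>) -(an_b w <|pm x, pm y|>) !cd_metric.
  rewrite !(cd_ipC C (pp x)) !(cd_ipC C (pm x)); ring.
Qed.

Lemma eproj_F L x : (forall x, L (F x) = F (L x)) -> F (eproj L x) = eproj L (F x).
Proof. by move=> LF; rewrite !eprojE (ac_Z acF) (ac_D acF) LF. Qed.

(** The half of [D0] in E+ is an instance of [mixed] for [K], the half in E- one for the opposite
    involution, whose closure hypothesis follows by changing signs. *)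
Lemma parallel_base_F : parallel D0 F.
Proof.
have KF' x : - K (F x) = F (- K x) by rewrite (acN acF) KF.
have intKF' : closed_eigenbundle (fun x => - K (F x)) u.
  move=> x y xu yu; have e := intKF xu yu.
  by rewrite !brNl !brNr !opprK e opprD.
move=> w x; apply: ip_inj => z; rewrite (ac_skew acF) !ipD0 -!eproj_F//.
rewrite (mixed acF iK KF intF intKF (Ka _) (K_pp _) (K_pp _)).
rewrite (mixed acF iK' KF' intF intKF') ?K_pm ?K_b ?opprK//; ring.
Qed.

Lemma parallel_base_K : parallel D0 K.
Proof.
have ppK x : pp (K x) = pp x by rewrite !eprojE (inv_K iK) addrC.
have pmK x : pm (K x) = - pm x.
  by rewrite !eprojE (inv_K iK) -scalerN opprD opprK addrC.
move=> w x; apply: ip_inj => z; rewrite (inv_sym iK) !ipD0 !ppK !pmK.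
by rewrite !brE !ipE.
Qed.

Variable tau : G -> G -> G.
Hypothesis tau_def : forall x y, tau x y = D0 x y - D0 y x - br x y
  + a' (br (pp x) (pp y)) + br (pm x) (pm y) - a (br (pm x) (pm y)).

Lemma br_rotate L s x y : involution L -> L s = - s -> L x = x -> L y = y ->
  <|br s x, y|> = <|br x y, s|>.
Proof.
move=> iL Ls Lx Ly; rewrite ip_brC (ip_eigen iL Ls Lx) an0 ip_br_swap.
by rewrite (ip_eigen iL Ls Ly) an0 !sub0r opprK.
Qed.

(** In <D0_z x, y> the section [z] occurs inside a bracket. [br_rotate] brings [a z] and [b z] out
    into the pairing, and the adjoints [a'] and 1 - a then free [z]; this is where the last three
    terms of [tau] come from. *)
Lemma tau_base x y z : <|tau x y, z|> = tor D0 x y z.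
Proof.
rewrite /tor tau_def !ipE (ipD0 z x).
rewrite (br_rotate iK (Ka _)) ?K_pp// (br_rotate (s := b z) iK') ?K_pm ?K_b ?opprK//.
rewrite bE !ipE -(a_adj _ z) (cd_ipC C (a' _)) -a_adj (cd_ipC C (a z)); ring.
Qed.

(** Some two of the three arguments have equal sign. In the direction of the odd one out, [D0] is by
    construction the projected bracket, which cancels the bracket in the torsion; the remaining
    terms pair opposite eigenvectors. *)
Lemma tor_base_mixed x y z : K y = y -> K z = - z -> tor D0 x y z = 0.
Proof.
have cD := connection_base.
have Dm w v : K v = - v -> K (D0 w v) = - D0 w v.
  by move=> Kv; rewrite -parallel_base_K Kv -scaleN1r (con_Zr cD) anN an1 oppr0
    scale0r add0r scaleN1r.
have Dp w v : K v = v -> K (D0 w v) = D0 w v by move=> Kv; rewrite -parallel_base_K Kv.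
have pm0 v : K v = v -> pm v = 0 by move=> Kv; rewrite eprojE Kv subrr scaler0.
have pp0 v : K v = - v -> pp v = 0 by move=> Kv; rewrite eprojE Kv subrr scaler0.
have br0r v : br v 0 = 0 by rewrite -[X in br v X](scale0r v) cd_brZr an0 !scale0r addr0.
have m1 s p p' : K s = - s -> K p = p -> K p' = p' -> tor D0 s p p' = 0.
  move=> Ks Kp Kp'; rewrite /tor !ipE ipD0 pm0// br0r ip0l addr0 !(eproj_id Kp) !(eproj_id Kp').
  by rewrite a_id// (ip_eigen iK (Dm _ _ Ks) Kp') (ip_eigen iK (Dm _ _ Ks) Kp); ring.
have m2 p s s' : K p = p -> K s = - s -> K s' = - s' -> tor D0 p s s' = 0.
  move=> Kp Ks Ks'; rewrite /tor !ipE ipD0 pp0// br0r ip0l add0r !pm_eq//.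
  rewrite b_id// (cd_ipC C (D0 s p)) (cd_ipC C (D0 s' p)).
  by rewrite (ip_eigen iK Ks' (Dp _ _ Kp)) (ip_eigen iK Ks (Dp _ _ Kp)); ring.
move=> Ky Kz; rewrite (eproj_sum x) (torDl cD) -(tor_cycle cD z) m1 ?K_pp//.
by rewrite (tor_cycle cD) m2 ?K_pm// addr0.
Qed.

Lemma tor_base_inv x y z : tor D0 x (K y) z = tor D0 x y (K z).
Proof.
have cD := connection_base.
rewrite (eproj_sum y) (eproj_sum z) !(inv_D iK) !K_pp !K_pm !(torE cD).
rewrite (tor_skewr cD x (pm y)) !(tor_base_mixed x (K_pp _) (K_pm _)); ring.
Qed.

End BaseConnection.

Theorem exists_parallel_torsion_free (F K a a' : G -> G) (u : G) (eps : A) :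
  almost_complex F u eps -> involution K -> (forall x, K (F x) = F (K x)) ->
  closed_eigenbundle F u -> closed_eigenbundle (fun x => K (F x)) u ->
  (forall x y, a (x + y) = a x + a y) -> (forall f x, a (f *: x) = f *: a x) ->
  (forall x y, <|a x, y|> = <|x, a' y|>) ->
  (forall x, K (a x) = - a x) -> (forall x, K x = - x -> a x = x) ->
  (forall x f, an (a x) f = an x f) ->
  (forall x, (forall f, an x f = 0) -> a x = 0) ->
  exists D, [/\ connection D, parallel D F, parallel D K &
    forall x y z, tor D x y z = 0].
Proof.
move=> acF iK KF intF intKF aD aZ a_adj Ka a_id an_a an_inj.
pose K' x := - K x; pose b x := x - a' x.
pose D0 w x := eproj K (br (a w) (eproj K x)) + eproj K' (br (b w) (eproj K' x)).
pose tau x y := D0 x y - D0 y x - br x y + a' (br (eproj K x) (eproj K y))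
  + br (eproj K' x) (eproj K' y) - a (br (eproj K' x) (eproj K' y)).
have bE x : b x = x - a' x by [].
have D0E w x : D0 w x = eproj K (br (a w) (eproj K x)) +
  eproj K' (br (b w) (eproj K' x)) by [].
have tauE x y : tau x y = D0 x y - D0 y x - br x y + a' (br (eproj K x) (eproj K y))
  + br (eproj K' x) (eproj K' y) - a (br (eproj K' x) (eproj K' y)) by [].
have cD : connection D0 by exact: (connection_base acF iK aD aZ a_adj Ka a_id an_a an_inj bE D0E).
have DF : parallel D0 F by exact: (parallel_base_F acF iK KF intF intKF a_adj Ka a_id bE D0E).
have DK : parallel D0 K by exact: (parallel_base_K iK D0E).
have tauT := tau_base iK a_adj Ka a_id bE D0E tauE.
have TK := tor_base_inv acF iK aD aZ a_adj Ka a_id an_a an_inj bE D0E.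
pose P := perp u eps.
pose N w := - (half * half) *: P w - half *: proj_u u eps w.
pose S w x := P (tau (N w) (P x)) - F (tau (N w) (F x)).
pose D w x := D0 w x + S w x.
have NE w : N w = - (half * half) *: P w - half *: proj_u u eps w by [].
have SE w x : S w x = P (tau (N w) (P x)) - F (tau (N w) (F x)) by [].
have DE w x : D w x = D0 w x + S w x by [].
exists D; split.
- exact: (connection_corrected cD acF tauT NE SE DE).
- exact: (parallel_corrected_F cD acF DF tauT SE DE).
- exact: (parallel_corrected_K acF iK KF DK tauT TK SE DE).
- exact: (torsion_free_corrected cD acF DF intF tauT NE SE DE).
Qed.

End CourantDorfmanTheory.

(** * Smooth functions and bump functions *)

Section EuclideanCalculus.
Variables (R : realType) (n : nat).
Implicit Types (U V : set 'rV[R]_n) (f g : 'rV[R]_n -> R) (k : nat).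

Lemma Ck_onW k U f : Ck_on k.+1 U f -> Ck_on k U f.
Proof.
elim: k f => [|k IH] f /= [cf df]; first by split.
by split=> // i; have [dfi kfi] := df i; split=> //; apply: IH.
Qed.

Lemma Ck_on_local k U f :
  (forall x, U x -> exists2 V, V x & Ck_on k V f) -> Ck_on k U f.
Proof.
elim: k f => [|k IH] f Uf; split=> //.
- by move=> x; rewrite inE => /Uf[V Vx [cf _]]; apply: cf; rewrite inE.
- by move=> x; rewrite inE => /Uf[V Vx [cf _]]; apply: cf; rewrite inE.
move=> i; split=> [x /Uf[V Vx [_ /(_ i)[df _]]]|]; first exact: df.
by apply: IH => x /Uf[V Vx [_ /(_ i)[_ kf]]]; exists V.
Qed.

Lemma near_in_open U f g x : open U -> U x -> {in U, f =1 g} ->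
  \forall y \near x, f y = g y.
Proof.
move=> oU Ux fg; near=> y; apply: fg; rewrite inE.
by near: y; exact: open_nbhs_nbhs.
Unshelve. all: by end_near. Qed.

Lemma Ck_on_ext k U f g : open U -> {in U, f =1 g} -> Ck_on k U f ->
  Ck_on k U g.
Proof.
elim: k f g => [|k IH] f g oU fg /= [cf df].
all: have cg : {in U, continuous g}.
1,3: move=> x xU; have Ux := set_mem xU; rewrite /continuous_at -(fg _ xU);
     apply: (cvg_trans _ (cf _ xU));
     apply: (near_eq_cvg (F := nbhs x)); exact: (near_in_open oU Ux fg).
  by [].
split=> // i; have [dfi kfi] := df i; split=> [x Ux|].
  by apply: near_eq_derivable (dfi x Ux); exact: (near_in_open oU Ux fg).
apply: IH kfi => // x xU; apply: near_eq_derive.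
by apply: (near_in_open (U := U)) => //; exact: set_mem.
Qed.

Lemma Ck_on_cst k U c : Ck_on k U (fun=> c).
Proof.
have cc : {in U, continuous (fun=> c : R)} by move=> x _; exact: cst_continuous.
elim: k c cc => [|k IH] c cc; split=> // i; split=> [x _|]; first exact: derivable_cst.
have -> : (fun x => 'D_(delta_mx 0 i) (fun=> c) x) = (fun _ : 'rV[R]_n => 0 : R).
  by apply/funext => x; exact: derive_cst.
by apply: IH => x _; exact: cst_continuous.
Qed.

Lemma Ck_on_add k U f g : open U -> Ck_on k U f -> Ck_on k U g ->
  Ck_on k U (fun x => f x + g x).
Proof.
elim: k f g => [|k IH] f g oU /= [cf df] [cg dg].
all: have cfg : {in U, continuous (fun x => f x + g x)}
  by move=> x xU; apply: (@continuousD _ _ _ f g x); [exact: cf|exact: cg].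
  by [].
split=> // i; have [dfi kfi] := df i; have [dgi kgi] := dg i; split=> [x Ux|].
  by apply: (derivableD (f := f) (g := g)); [exact: dfi|exact: dgi].
apply: Ck_on_ext (IH _ _ oU kfi kgi) => // x; rewrite inE => Ux /=.
by rewrite -(deriveD (f := f) (g := g))//; [exact: dfi|exact: dgi].
Qed.

Lemma Ck_on_mul k U f g : open U -> Ck_on k U f -> Ck_on k U g ->
  Ck_on k U (fun x => f x * g x).
Proof.
elim: k f g => [|k IH] f g oU kf kg.
all: have cfg : {in U, continuous (fun x => f x * g x)}
  by move=> x xU; apply: (@continuousM _ _ f g x);
     [case: kf => + _; exact|case: kg => + _; exact].
  by [].
have [kf' kg'] := (Ck_onW kf, Ck_onW kg).
have [_ df] := kf; have [_ dg] := kg.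
split=> // i; have [dfi kfi] := df i; have [dgi kgi] := dg i; split=> [x Ux|].
  by apply: (derivableM (f := f) (g := g)); [exact: dfi|exact: dgi].
apply: Ck_on_ext (Ck_on_add oU (IH _ _ oU kf' kgi) (IH _ _ oU kg' kfi)) => //.
move=> x; rewrite inE => Ux /=.
by rewrite -(deriveM (f := f) (g := g))//; [exact: dfi|exact: dgi].
Qed.

Lemma Ck_on_inv k U f : open U -> (forall x, U x -> f x != 0) -> Ck_on k U f ->
  Ck_on k U (fun x => (f x)^-1).
Proof.
move=> oU f0; elim: k => [|k IH] kf.
all: have cf' : {in U, continuous (fun x => (f x)^-1)}
  by move=> x xU; apply: (@continuousV _ _ f x);
     [apply: f0; rewrite -in_setE|case: kf => + _; exact].
  by [].
have kf' := Ck_onW kf; have [_ df] := kf.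
split=> // i; have [dfi kfi] := df i; split=> [x Ux|].
  by apply: (derivableV (f := f)); [exact: f0|exact: dfi].
have kV := IH kf'.
apply: Ck_on_ext (Ck_on_mul oU (Ck_on_mul oU (Ck_on_cst k U (-1))
  (Ck_on_mul oU kV kV)) kfi) => //.
move=> x; rewrite inE => Ux /=.
rewrite (deriveV (f := f))//; [|exact: f0|exact: dfi].
by rewrite -exprVn expr2 mulN1r.
Qed.

Lemma derive_line (g : 'rV[R]_n -> R) (x e : 'rV[R]_n) :
  'D_1 (fun h : R => g (h *: e + x)) 0 = 'D_e g x.
Proof.
rewrite /derive; set g1 := fun h => h^-1 *: _; set g2 := fun h => h^-1 *: _.
suff -> : g1 = g2 by [].
by rewrite funeqE /g1 /g2 => h /=; rewrite addr0 scale0r add0r [_%:A]mulr1.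
Qed.

(** The outer function comes with the sequence of its derivatives, so the induction on [k] passes to
    the shifted sequence [H \o S]. *)
Lemma Ck_on_comp (H : nat -> R -> R) k U f : open U ->
  (forall j (x : R), is_derive x 1 (H j) (H j.+1 x)) -> Ck_on k U f ->
  Ck_on k U (fun x => H 0%N (f x)).
Proof.
move=> oU + kf; elim: k H kf => [|k IH] H kf dH.
all: have cf' : {in U, continuous (fun x => H 0%N (f x))}.
1,3: move=> x xU; apply: (@continuous_comp _ _ _ f (H 0%N));
     [case: kf => + _; exact|];
     have [dH0 _] := dH 0%N (f x);
     by apply/differentiable_continuous; apply/derivable1_diffP.
  by [].
have kf' := Ck_onW kf; have [_ df] := kf.
have dcomp i x : U x -> is_derive x (delta_mx 0 i) (fun x => H 0%N (f x))
    (H 1%N (f x) * 'D_(delta_mx 0 i) f x).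
  move=> Ux; have [/(_ _ Ux) dfi _] := df i.
  set e := delta_mx 0 i in dfi *.
  pose l := fun h : R => f (h *: e + x).
  have l0 : l 0 = f x by rewrite /l scale0r add0r.
  have lD : is_derive (0 : R) 1 l ('D_e f x).
    have ld : derivable l 0 1 by case: (derivable1P f x e) => + _; exact.
    apply: (DeriveDef ld).
    exact: derive_line.
  have HD : is_derive (l 0) 1 (H 0%N) (H 1%N (f x)) by rewrite l0; exact: dH.
  have [dc vc] := is_derive1_comp HD lD.
  have ld : derivable (fun x => H 0%N (f x)) x e.
    by case: (derivable1P (fun x => H 0%N (f x)) x e) => _; exact.
  apply: (DeriveDef ld).
  by rewrite -vc -derive_line.
split=> // i; have [dfi kfi] := df i; split=> [x /(dcomp i)[]//|].
apply: Ck_on_ext (Ck_on_mul oU (IH (H \o S) kf' _) kfi) => //.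
  by move=> x; rewrite inE => /(dcomp i)[_ ->].
Qed.

End EuclideanCalculus.

(** * The flat function exp(-1/t) and all its derivatives *)

Section FlatFunction.
Variable R : realType.
Implicit Types (p : {poly R}) (s t : R).

(** The polynomial factor in 1/t makes the family closed under differentiation: the derivative
    replaces [p] by X^2 (p - p'). *)
Definition flat p t : R := if 0 < t then p.[t^-1] * expR (- t^-1) else 0.

Lemma poly_expRN_bounded p : exists2 C, 0 <= C &
  forall s, 0 <= s -> `|p.[s] * expR (- s)| <= C.
Proof.
exists (\sum_(i < size p) `|p`_i| * i`!%:R).
  by apply: sumr_ge0 => i _; rewrite mulr_ge0.
move=> s s0; rewrite horner_coef big_distrl /=.
apply: le_trans (ler_norm_sum _ _ _) _; apply: ler_sum => i _.
rewrite -mulrA normrM ler_wpM2l// ger0_norm; last first.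
  by rewrite mulr_ge0 ?exprn_ge0// expR_ge0.
rewrite expRN ler_pdivrMr ?expR_gt0//.
case: (nat_of_ord i) => [|k].
  rewrite expr0 fact0 mul1r; apply: le_trans (expR_ge1Dx s).
  by rewrite lerDl.
rewrite mulrC -ler_pdivrMr ?ltr0n ?fact_gt0//.
by apply: le_trans (expR_ge1Dxn k s0); rewrite lerDr.
Qed.

(** Bounding X^2 p instead of [p] gains a factor t^2, which makes the difference quotient at 0 tend
    to 0. *)
Lemma flat_le_sqr p : exists2 C, 0 <= C & forall t, `|flat p t| <= C * t ^+ 2.
Proof.
have [C C0 pC] := poly_expRN_bounded ('X^2 * p).
exists C => // t; rewrite /flat; case: ifPn => t0; last first.
  by rewrite normr0 mulr_ge0// sqr_ge0.
have := pC t^-1; rewrite invr_ge0 ltW// => /(_ isT).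
rewrite hornerM hornerXn -mulrA normrM ger0_norm ?exprn_ge0 ?invr_ge0 ?(ltW t0)//.
rewrite exprVn ler_pdivrMl ?exprn_gt0//.
by rewrite [_ * C]mulrC.
Qed.

Lemma is_derive_flat p t :
  is_derive t 1 (flat p) (flat ('X^2 * (p - p^`())) t).
Proof.
have [t0|t0|->] := ltgtP t 0.
- rewrite {2}/flat ltNge (ltW t0)/=.
  apply: (@near_eq_is_derive _ _ _ (fun=> 0)) => //.
  near=> x; rewrite /flat ltNge; suff -> : x <= 0 by [].
  by apply: ltW; near: x; exact: lt_nbhsl.
- rewrite {2}/flat t0.
  pose g : R -> R := fun x => p.[x^-1] * expR (- x^-1).
  apply: (@near_eq_is_derive _ _ _ g).
    by near=> x; rewrite /flat; suff -> : 0 < x by []; near: x; exact: lt_nbhsr.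
  have tn0 : t != 0 by rewrite gt_eqF.
  have dV : is_derive t 1 (fun x : R => x^-1) (- t ^- 2).
    apply: (is_derive_eq (@is_deriveV R id t 1 1 tn0 (is_derive_id _ _))).
    by rewrite [LHS]mulr1.
  have dp : is_derive t 1 (fun x => p.[x^-1]) ((p^`()).[t^-1] * - t ^- 2).
    by apply: (is_derive1_comp (f := horner p) (g := fun x => x^-1)).
  have de : is_derive t 1 (fun x => expR (- x^-1)) (expR (- t^-1) * t ^- 2).
    apply: (is_derive1_comp (f := expR) (g := fun x => - x^-1)).
    by rewrite -[t ^- 2]opprK; apply: is_deriveN.
  apply: (is_derive_eq (is_deriveM dp de)).
  rewrite hornerM hornerXn hornerD hornerN exprVn /GRing.scale /=.
  ring.
- rewrite {2}/flat ltxx.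
  have f0 : flat p 0 = 0 by rewrite /flat ltxx.
  have [C C0 pC] := flat_le_sqr p.
  suff cv : (fun h => h^-1 *: ((flat p \o shift 0) (h *: 1) - flat p 0))
      @ (0 : R)^' --> (0 : R).
    split; last exact/cvg_lim.
    by apply/cvg_ex; exists 0.
  have C1 : 0 < C + 1 by rewrite ltr_wpDl.
  apply/cvgr0Pnorm_lt => e e0; have eC0 : 0 < e / (C + 1) by rewrite divr_gt0.
  near=> h.
  have h0 : h != 0 by near: h; exact: nbhs_dnbhs_neq.
  rewrite f0 subr0 /= addr0 [_%:A]mulr1 normrM normfV.
  rewrite ltr_pdivrMl ?normr_gt0//; apply: le_lt_trans (pC h) _.
  rewrite -[h ^+ 2]ger0_norm ?sqr_ge0// normrX expr2 mulrA mulrC.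
  rewrite ltr_pM2l ?normr_gt0//.
  have he : `|h| < e / (C + 1).
    by near: h; exact: dnbhs0_lt.
  apply: (@le_lt_trans _ _ ((C + 1) * `|h|)); first by rewrite ler_wpM2r// lerDl.
  by rewrite mulrC -ltr_pdivlMr.
Unshelve. all: by end_near. Qed.

Definition flat_deriv (j : nat) : R -> R :=
  flat (iter j (fun p => 'X^2 * (p - p^`())) 1).

Lemma is_derive_flat_deriv j t :
  is_derive t 1 (flat_deriv j) (flat_deriv j.+1 t).
Proof. exact: is_derive_flat. Qed.

Lemma flat_deriv0_gt0 t : 0 < t -> 0 < flat_deriv 0 t.
Proof. by move=> t0; rewrite /flat_deriv /flat t0 hornerC mul1r expR_gt0. Qed.

Lemma flat_deriv0_eq0 t : t <= 0 -> flat_deriv 0 t = 0.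
Proof. by move=> t0; rewrite /flat_deriv /flat ltNge t0. Qed.

End FlatFunction.

(** * Smooth functions on a manifold *)

Section ManifoldFunctions.
Variables (R : realType) (n : nat) (M : manifold R n).
Implicit Types (U V W : set M) (f g : M -> R).

Lemma chart_img_open_sub (c : chart R n M) U : open U ->
  open (chart_map c @` (chart_dom c `&` U)).
Proof.
move=> oU; rewrite openE => _ [q [qc Uq] <-].
have cq : (chart_map c @` chart_dom c) (chart_map c q) by exists q.
have oc := @chart_img_open _ _ _ c.
have n1 : \forall y \near chart_map c q, (chart_map c @` chart_dom c) y.
  by apply: open_nbhs_nbhs.
have n2 : \forall y \near chart_map c q, U (chart_inv c y).
  have := @chart_inv_continuous _ _ _ c _ (mem_set cq).
  by apply; rewrite chart_mapK//; apply: open_nbhs_nbhs.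
apply: filterS2 n1 n2 => y [q' q'c <-]; rewrite chart_mapK// => Uq'.
by exists q'.
Qed.

Lemma smooth_on_local U f :
  (forall p, U p -> exists2 V, V p & smooth_on V f) -> smooth_on U f.
Proof.
move=> Uf c ac k; apply: Ck_on_local => _ [q [qc Uq] <-].
have [V Vq sV] := Uf q Uq; exists (chart_map c @` (chart_dom c `&` V)).
  by exists q.
exact: sV.
Qed.

Lemma smooth_on_sub U V f : U `<=` V -> smooth_on V f -> smooth_on U f.
Proof. by move=> UV sf; apply: smooth_on_local => p /UV Vp; exists V. Qed.

Lemma smooth_onT U f : smooth f -> smooth_on U f.
Proof. exact: smooth_on_sub. Qed.

Lemma smooth_on_ext U f g : open U -> (forall p, U p -> f p = g p) ->
  smooth_on U f -> smooth_on U g.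
Proof.
move=> oU fg sf c ac k; apply: Ck_on_ext (sf c ac k).
  exact: chart_img_open_sub.
by move=> x; rewrite inE => -[q [qc Uq] <-]; rewrite chart_mapK// fg.
Qed.

Lemma smooth_on_cst U a : smooth_on U (fun=> a).
Proof. by move=> c ac k; exact: Ck_on_cst. Qed.

Lemma smooth_on_add U f g : open U -> smooth_on U f -> smooth_on U g ->
  smooth_on U (fun p => f p + g p).
Proof.
move=> oU sf sg c ac k.
by apply: Ck_on_add; [exact: chart_img_open_sub|exact: sf|exact: sg].
Qed.

Lemma smooth_on_mul U f g : open U -> smooth_on U f -> smooth_on U g ->
  smooth_on U (fun p => f p * g p).
Proof.
move=> oU sf sg c ac k.
by apply: Ck_on_mul; [exact: chart_img_open_sub|exact: sf|exact: sg].
Qed.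

Lemma smooth_on_inv U f : open U -> (forall p, U p -> f p != 0) ->
  smooth_on U f -> smooth_on U (fun p => (f p)^-1).
Proof.
move=> oU f0 sf c ac k; apply: Ck_on_inv; [exact: chart_img_open_sub| |exact: sf].
by move=> _ [q [qc Uq] <-]; rewrite chart_mapK//; exact: f0.
Qed.

Lemma smooth_on_opp U f : open U -> smooth_on U f -> smooth_on U (fun p => - f p).
Proof.
move=> oU sf; apply: (@smooth_on_ext _ (fun p => -1 * f p)) => //.
  by move=> p _; rewrite mulN1r.
by apply: smooth_on_mul => //; exact: smooth_on_cst.
Qed.

Lemma smooth_on_sum (I : Type) (s : seq I) (P : pred I) (f : I -> M -> R) U :
  open U -> (forall i, P i -> smooth_on U (f i)) ->
  smooth_on U (fun p => \sum_(i <- s | P i) f i p).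
Proof.
move=> oU sf; elim: s => [|i s IH].
  by apply: (smooth_on_ext oU _ (@smooth_on_cst U _)) => p _; rewrite big_nil.
case Pi: (P i); last by apply: (smooth_on_ext oU _ IH) => p _; rewrite big_cons Pi.
apply: (smooth_on_ext oU _ (smooth_on_add oU (sf i Pi) IH)) => p _.
by rewrite big_cons Pi.
Qed.

Lemma smooth_on_prod (I : Type) (s : seq I) (P : pred I) (f : I -> M -> R) U :
  open U -> (forall i, P i -> smooth_on U (f i)) ->
  smooth_on U (fun p => \prod_(i <- s | P i) f i p).
Proof.
move=> oU sf; elim: s => [|i s IH].
  by apply: (smooth_on_ext oU _ (@smooth_on_cst U _)) => p _; rewrite big_nil.
case Pi: (P i); last by apply: (smooth_on_ext oU _ IH) => p _; rewrite big_cons Pi.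
apply: (smooth_on_ext oU _ (smooth_on_mul oU (sf i Pi) IH)) => p _.
by rewrite big_cons Pi.
Qed.

Lemma smooth_on_comp (H : nat -> R -> R) U f : open U ->
  (forall j (x : R), is_derive x 1 (H j) (H j.+1 x)) -> smooth_on U f ->
  smooth_on U (fun p => H 0%N (f p)).
Proof.
move=> oU dH sf c ac k.
by apply: (@Ck_on_comp _ _ H) => //; [exact: chart_img_open_sub|exact: sf].
Qed.

Lemma smooth_on_continuous U f p : open U -> U p -> smooth_on U f ->
  {for p, continuous f}.
Proof.
move=> oU Up sf; have [c ac cp] := atlas_cover p.
have [cf _] := sf c ac 0%N.
have cont : {for p, continuous (fun q => f (chart_inv c (chart_map c q)))}.
  apply: (@continuous_comp _ _ _ (chart_map c) (fun x => f (chart_inv c x))).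
    by apply: chart_map_continuous; exact: mem_set.
  by apply: cf; apply: mem_set; exists p.
rewrite /prop_for /continuous_at chart_mapK// in cont.
apply: (cvg_trans _ cont); apply: (near_eq_cvg (F := nbhs p)).
have oc := @chart_dom_open _ _ _ c.
have n1 : \forall q \near p, chart_dom c q by exact: open_nbhs_nbhs.
by apply: filterS n1 => q qc; rewrite chart_mapK.
Qed.

Lemma smooth_on_neq0 U f p : open U -> U p -> smooth_on U f -> f p != 0 ->
  exists V, [/\ open V, V p, V `<=` U & forall q, V q -> f q != 0].
Proof.
move=> oU Up sf fp.
have cf := smooth_on_continuous oU Up sf.
have n1 : \forall q \near p, f q != 0.
  by apply: (cf [set x | x != 0]); apply: open_nbhs_nbhs; split => //; exact: open_neq.
have n2 : \forall q \near p, U q by exact: open_nbhs_nbhs.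
exists (interior [set q | f q != 0 /\ U q]); split.
- exact: open_interior.
- exact: filterS2 n1 n2.
- by move=> q /interior_subset[].
- by move=> q /interior_subset[].
Qed.

Lemma smooth_on_chart (c : chart R n M) i : atlas c ->
  smooth_on (chart_dom c) (fun p => chart_map c p 0 i).
Proof. by move=> ac c' ac'; exact: atlas_smooth. Qed.

(* The bump is exp(-1/t) with t = d^2 - |x - a|^2 in a chart; being a function
   of one real variable composed with a polynomial in the coordinates, its
   smoothness in other charts needs no multivariate chain rule. *)
Lemma bump_exists U p : open U -> U p -> exists (f : M -> R) (C : set M),
  [/\ smooth f, f p = 1, closed C, C `<=` U & forall q, ~ C q -> f q = 0].
Proof.
move=> oU Up; have [c ac cp] := atlas_cover p.
pose a := chart_map c p.
have oA := @chart_img_open_sub c U oU.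
have Aa : (chart_map c @` (chart_dom c `&` U)) a by exists p.
have [e e0 eA] : exists2 e, 0 < e & forall x : 'rV[R]_n,
    (forall i, `|a 0 i - x 0 i| <= e) -> (chart_map c @` (chart_dom c `&` U)) x.
  have /nbhs_ballP[e /= e0 eA] : nbhs a (chart_map c @` (chart_dom c `&` U)).
    exact: open_nbhs_nbhs.
  exists (e / 2); first by rewrite divr_gt0.
  move=> x ax; apply: eA; split => // i j; rewrite (ord1 i).
  apply: le_lt_trans (ax j) _; lra.
(* A closed box is compact as a product of segments, and its preimage in M is then closed because M
   is Hausdorff. The ball of radius [e] on which [r] is positive lies inside it. *)
pose K := [set x : 'rV[R]_n | forall i, `[a 0 i - e, a 0 i + e]%classic (x 0 i)].
have cK : compact K.
  apply: (@rV_compact R n (fun i => `[a 0 i - e, a 0 i + e]%classic)) => i.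
  exact: segment_compact.
have Ke x : K x <-> forall i, `|a 0 i - x 0 i| <= e.
  by split=> Kx i; have := Kx i; rewrite /= in_itv /= ler_distlC => /andP[? ?];
     apply/andP; split; lra.
have KA : K `<=` chart_map c @` (chart_dom c `&` U) by move=> x /Ke; exact: eA.
pose C := chart_inv c @` K.
have CU : C `<=` U.
  by move=> _ [x /KA[q [qc Uq] <-] <-]; rewrite chart_mapK.
have clC : closed C.
  apply: compact_closed; first exact: manifold_hausdorff.
  apply: continuous_compact => //; apply: continuous_in_subspaceT => x.
  rewrite inE => /KA[q [qc Uq] <-]; apply: chart_inv_continuous.
  by rewrite inE; exists q.
pose r q := e ^+ 2 - \sum_i (a 0 i - chart_map c q 0 i) ^+ 2.
pose f q := if `[< chart_dom c q >] then flat_deriv 0 (r q) else 0.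
have fC q : ~ C q -> f q = 0.
  rewrite /f; case: asboolP => // qc Cq; apply: flat_deriv0_eq0.
  rewrite /r subr_le0 leNgt; apply/negP => lt_e; apply: Cq.
  exists (chart_map c q); last by rewrite chart_mapK.
  apply/Ke => i; rewrite -(@ler_pXn2r _ 2%N) ?nnegrE ?(ltW e0)// real_normK ?num_real//.
  apply: le_trans (ltW lt_e).
  by rewrite (bigD1 i)//= lerDl sumr_ge0// => j _; rewrite sqr_ge0.
have fp : 0 < f p.
  rewrite /f asboolT//; apply: flat_deriv0_gt0.
  rewrite /r big1 ?subr0 ?exprn_gt0// => i _.
  by rewrite /a subrr expr0n.
have sf : smooth f.
  apply: smooth_on_local => q _.
  (* A point off the chart has the complement of [C] as a neighbourhood, and the function is zero
     there. *)
  have [qc|qc] := pselect (chart_dom c q); last first.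
    exists (~` C).
      by move=> [x /KA[q' [q'c _] <-]]; rewrite chart_mapK// => q'q; apply: qc; rewrite -q'q.
    apply: (@smooth_on_ext _ (fun=> 0)); [exact: closed_openC| |exact: smooth_on_cst].
    by move=> q' /fC.
  exists (chart_dom c) => //; have oc := @chart_dom_open _ _ _ c.
  apply: (@smooth_on_ext _ (fun q => flat_deriv 0 (r q))) => //.
    by move=> q' q'c; rewrite /f asboolT.
  apply: smooth_on_comp => //; first exact: is_derive_flat_deriv.
  apply: smooth_on_add => //; first exact: smooth_on_cst.
  apply: smooth_on_opp => //; apply: smooth_on_sum => // i _.
  have sd : smooth_on (chart_dom c) (fun q => a 0 i - chart_map c q 0 i).
    apply: smooth_on_add => //; first exact: smooth_on_cst.
    by apply: smooth_on_opp => //; exact: smooth_on_chart.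
  by apply: smooth_on_mul.
exists (fun q => (f p)^-1 * f q), C; split => //.
- by apply: smooth_on_mul => //; [exact: openT|exact: smooth_on_cst].
- by rewrite mulVf// gt_eqF.
- by move=> q /fC ->; rewrite mulr0.
Qed.

Lemma smooth_on_bump U W f (C : set M) g : open U -> open W -> smooth f ->
  closed C -> C `<=` U -> (forall q, ~ C q -> f q = 0) ->
  smooth_on (W `&` U) g -> smooth_on W (fun q => f q * g q).
Proof.
move=> oU oW sf clC CU fC sg; apply: smooth_on_local => q Wq.
have [Uq|nUq] := pselect (U q).
  exists (W `&` U) => //; have oWU : open (W `&` U) by exact: openI.
  by apply: smooth_on_mul => //; exact: smooth_onT.
exists (~` C); first by move=> /CU.
apply: (@smooth_on_ext _ (fun=> 0)); [exact: closed_openC| |exact: smooth_on_cst].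
by move=> q' /fC ->; rewrite mul0r.
Qed.

End ManifoldFunctions.

(** * Smooth sections *)

Lemma linear_hom (K : fieldType) (U V : vectType K) (f : U -> V) : linear f ->
  exists g : 'Hom(U, V), forall v, g v = f v.
Proof.
move=> lf; pose lm := GRing.isLinear.Build K U V *:%R f lf.
pose g : {linear U -> V} := HB.pack f lm.
by exists (linfun g) => v; rewrite lfunE.
Qed.

(** * Separating functionals, linear systems and Gram matrices *)

Section LinearAlgebra.
Variables (K : fieldType) (V : vectType K).

Lemma functional_sum (phi : V -> K) (I : Type) (q : seq I) (c : I -> K) (v : I -> V) :
  (forall a u w, phi (a *: u + w) = a * phi u + phi w) ->
  phi (\sum_(i <- q) c i *: v i) = \sum_(i <- q) c i * phi (v i).
Proof.
move=> lin; have phi0 : phi 0 = 0.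
  have := lin 1 0 0; rewrite scaler0 addr0 mul1r => /esym/eqP.
  by rewrite -subr_eq0 addrK => /eqP.
elim: q => [|i q IH]; first by rewrite !big_nil.
by rewrite !big_cons lin IH.
Qed.

(** Functionals are chosen one at a time: while there are fewer than [k], some nonzero combination
    of the vectors is killed by all of them, and a functional that does not kill it raises the rank.
    It later selects finitely many test functions for the anchor. *)
Lemma linear_separating_unit (I : Type) k (s : 'I_k -> V) (phi : I -> V -> K) :
  (forall i a u w, phi i (a *: u + w) = a * phi i u + phi i w) ->
  (forall c : 'I_k -> K, (forall i, phi i (\sum_l c l *: s l) = 0) ->
     forall l, c l = 0) ->
  exists f : 'I_k -> I, \matrix_(l < k, m < k) phi (f m) (s l) \in unitmx.
Proof.
move=> lin sep.
have phi_sum i c := functional_sum (index_enum 'I_k) c s (lin i).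
suff H j : (j <= k)%N -> exists f : 'I_j -> I,
    \rank (\matrix_(l < k, m < j) phi (f m) (s l)) = j.
  have [f fk] := H k (leqnn k); exists f.
  by rewrite -row_free_unit; apply/eqP.
elim: j => [|j IH] jk.
  have f0 : 'I_0 -> I by case.
  by exists f0; rewrite thinmx0 mxrank0.
have [f fr] := IH (ltnW jk).
set B := \matrix_(l, m) _ in fr.
have : kermx B != 0.
  by rewrite -mxrank_eq0 mxrank_ker fr subn_eq0 -ltnNge.
move=> /rowV0Pn[c /sub_kermxP cB c0].
have [i ci] : exists i, phi i (\sum_l c 0 l *: s l) != 0.
  apply: contrapT => /forallNP h; move/eqP: c0; apply.
  apply/rowP => l; rewrite mxE; apply: (sep (fun l => c 0 l)) => i.
  by apply/eqP/negPn/negP/h.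
pose f' (m : 'I_(j + 1)) := match fintype.split m with inl a => f a | inr _ => i end.
have fE : \matrix_(l < k, m < j + 1) phi (f' m) (s l) =
    row_mx B (\col_l phi i (s l)).
  by apply/matrixP => l m; rewrite !mxE /f'; case: split_ordP => m' _; rewrite !mxE.
suff rk : \rank (row_mx B (\col_l phi i (s l))) = (j + 1)%N.
  rewrite -addn1; exists f'; by rewrite fE.
apply/eqP; rewrite -mxrank_tr tr_row_mx.
rewrite eqn_leq rank_leq_row /=.
apply: (@leq_trans (\rank (B^T) + \rank ((\col_l phi i (s l))^T))).
  rewrite mxrank_tr fr leq_add2l lt0n mxrank_eq0; apply: contraNneq ci => e.
  rewrite phi_sum big1// => l _; have /matrixP/(_ 0 l) := e.
  by rewrite !mxE => ->; rewrite mulr0.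
rewrite -mxrank_sum_cap addsmxE.
suff -> : \rank (B^T :&: (\col_l phi i (s l))^T)%MS = 0%N by rewrite addn0.
apply/eqP; rewrite mxrank_eq0 -submx0; apply/rV_subP => v; rewrite sub_capmx.
case/andP => /submxP[x ->] /submxP[y xy].
(* [c] annihilates the old columns but not the new one, so the new one is independent of them. *)
have : (c *m (x *m B^T)^T) = 0 by rewrite trmx_mul trmxK mulmxA cB mul0mx.
rewrite xy trmx_mul trmxK mulmxA.
have -> : c *m (\col_l phi i (s l)) = (phi i (\sum_l c 0 l *: s l))%:M.
  apply/matrixP => a b; rewrite !ord1 !mxE eqxx mulr1n phi_sum.
  by apply: eq_bigr => l _; rewrite mxE.
rewrite mul_scalar_mx => /eqP; rewrite scaler_eq0 (negPf ci) /= => /eqP y0.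
by rewrite -[y]trmxK y0 trmx0 mul0mx submx0.
Qed.

Lemma linear_system_solve k (s : 'I_k -> V) (phi : 'I_k -> V -> K) (t : 'I_k -> K) :
  (forall i a u w, phi i (a *: u + w) = a * phi i u + phi i w) ->
  \matrix_(l < k, m < k) phi m (s l) \in unitmx ->
  exists c : 'I_k -> K, forall m, phi m (\sum_l c l *: s l) = t m.
Proof.
move=> lin; set B := \matrix_(_, _) _ => uB.
exists (fun l => ((\row_m t m) *m invmx B) 0 l) => m.
transitivity (((\row_m t m) *m invmx B *m B) 0 m).
  by rewrite mxE functional_sum//; apply: eq_bigr => l _; rewrite !mxE.
by rewrite mulmxKV// mxE.
Qed.

Lemma symmetricC (b : {symmetric V}) u v : b u v = b v u.
Proof. by rewrite hermC expr0 mul1r. Qed.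

Lemma gram_unit (b : {symmetric V}) k (s : 'I_k -> V) (W : {vspace V}) :
  (forall l, s l \in W) ->
  (forall c : 'I_k -> K, \sum_l c l *: s l = 0 -> forall l, c l = 0) ->
  (forall w, w \in W -> exists c : 'I_k -> K, w = \sum_l c l *: s l) ->
  (forall u, u \in W -> (forall v, v \in W -> b u v = 0) -> u = 0) ->
  \matrix_(l < k, m < k) b (s l) (s m) \in unitmx.
Proof.
move=> sW fr sp nd; rewrite -row_free_unit; apply: inj_row_free => c cB.
have c0 : \sum_l c 0 l *: s l = 0.
  apply: nd; first by apply: memv_suml => l _; rewrite memvZ.
  move=> v /sp[d ->]; rewrite linear_sum big1// => m _; rewrite linearZ /=.
  rewrite symmetricC linear_sum /=.
  have /matrixP/(_ 0 m) := cB; rewrite !mxE => e.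
  rewrite -[RHS](mulr0 (d m)) -[in RHS]e; congr (_ * _).
  by apply: eq_bigr => l _; rewrite linearZ /= mxE [in RHS]symmetricC.
by apply/rowP => l; rewrite mxE; exact: (fr (fun l => c 0 l)).
Qed.

End LinearAlgebra.
Lemma nondegenerate_eq0 (K : fieldType) (V : vectType K) (b : {symmetric V}) u :
  nondegenerate b -> (forall v, b u v = 0) -> u = 0.
Proof.
move=> /eqP nd bu; apply/eqP; rewrite -memv0 -nd.
by apply/mem_orthovP => v _; exact: bu.
Qed.

Section Matrices.
Variables (R : realType) (n : nat) (M : manifold R n).

Lemma smooth_on_det (U : set M) k (A : M -> 'M[R]_k) : open U ->
  (forall i j, smooth_on U (fun p => A p i j)) -> smooth_on U (fun p => \det (A p)).
Proof.
move=> oU sA; apply: smooth_on_sum => // s _; apply: smooth_on_mul => //.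
  exact: smooth_on_cst.
by apply: smooth_on_prod.
Qed.

Lemma smooth_on_invmx (U : set M) k (A : M -> 'M[R]_k) : open U ->
  (forall i j, smooth_on U (fun p => A p i j)) ->
  (forall p, U p -> A p \in unitmx) ->
  forall i j, smooth_on U (fun p => invmx (A p) i j).
Proof.
move=> oU sA uA i j.
apply: (@smooth_on_ext _ _ _ _ (fun p => (\det (A p))^-1 * \adj (A p) i j)) => //.
  by move=> p Up; rewrite /invmx uA// !mxE.
apply: smooth_on_mul => //.
  apply: smooth_on_inv => //; last exact: smooth_on_det.
  by move=> p /uA; rewrite unitmxE unitfE.
apply: (@smooth_on_ext _ _ _ _ (fun p => cofactor (A p) j i)) => //.
  by move=> p _; rewrite mxE.
apply: smooth_on_mul => //; first exact: smooth_on_cst.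
apply: smooth_on_det => // i' j'.
by apply: (smooth_on_ext oU _ (sA _ _)) => p _; rewrite !mxE.
Qed.

End Matrices.

(** * Smoothness of sections, functionals and endomorphisms *)

Section BundleSections.
Variables (R : realType) (n : nat) (M : manifold R n) (r : nat).
Variable E : vector_bundle M r.
Implicit Types (U V W : set M) (s t : section E) (A : endo E).

Lemma frame_expand (e : local_frame r E) p (v : E p) : frame_dom e p ->
  v = \sum_(i < r) coord (e p) i v *: tnth (e p) i.
Proof.
move=> ep; have /span_basis eb := frame_basis ep.
rewrite {1}(coord_span (_ : v \in <<e p>>%VS)); last by rewrite eb memvf.
by apply: eq_bigr => i _; rewrite (tnth_nth 0).
Qed.

Lemma smooth_section_on_sub U V s : U `<=` V -> smooth_section_on V s ->
  smooth_section_on U s.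
Proof.
move=> UV sV e fe i; apply: smooth_on_sub (sV e fe i).
exact: setIS.
Qed.

Lemma smooth_section_onT U s : smooth_section s -> smooth_section_on U s.
Proof. exact: smooth_section_on_sub. Qed.

Lemma smooth_section_on_local U s :
  (forall p, U p -> exists2 V, V p & smooth_section_on V s) ->
  smooth_section_on U s.
Proof.
move=> Us e fe i; apply: smooth_on_local => p [ep /Us[V Vp sV]].
by exists (frame_dom e `&` V) => //; exact: sV.
Qed.

Lemma smooth_section_on_ext U s t : open U -> (forall p, U p -> s p = t p) ->
  smooth_section_on U s -> smooth_section_on U t.
Proof.
move=> oU st ss e fe i; apply: smooth_on_ext (ss e fe i).
  by apply: openI => //; exact: frame_dom_open.
by move=> p [_ Up]; rewrite st.
Qed.

Lemma smooth_section_on_frame (e : local_frame r E) i : frames e ->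
  smooth_section_on (frame_dom e) (fun p => tnth (e p) i).
Proof. by move=> fe e' fe' j; exact: frames_smooth. Qed.

Lemma smooth_section_on0 U : smooth_section_on U (fun p => 0 : E p).
Proof.
move=> e fe i; rewrite (_ : (fun p => _) = (fun=> 0)); first exact: smooth_on_cst.
by apply/funext => p; rewrite linear0.
Qed.

Lemma smooth_section_on_add U s t : open U -> smooth_section_on U s ->
  smooth_section_on U t -> smooth_section_on U (fun p => s p + t p).
Proof.
move=> oU ss st e fe i; have oe := @frame_dom_open _ _ _ _ _ e.
have oeU : open (frame_dom e `&` U) by exact: openI.
apply: (smooth_on_ext oeU _ (smooth_on_add oeU (ss e fe i) (st e fe i))) => p _.
by rewrite linearD.
Qed.

Lemma smooth_section_on_scale U (f : M -> R) s : open U -> smooth_on U f ->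
  smooth_section_on U s -> smooth_section_on U (fun p => f p *: s p).
Proof.
move=> oU sf ss e fe i; have oe := @frame_dom_open _ _ _ _ _ e.
have oeU : open (frame_dom e `&` U) by exact: openI.
have sf' : smooth_on (frame_dom e `&` U) f by apply: smooth_on_sub sf => p [].
apply: (smooth_on_ext oeU _ (smooth_on_mul oeU sf' (ss e fe i))) => p _.
by rewrite linearZ.
Qed.

Lemma smooth_section_on_opp U s : open U -> smooth_section_on U s ->
  smooth_section_on U (fun p => - s p).
Proof.
move=> oU ss; have sN := smooth_section_on_scale oU (@smooth_on_cst _ _ M U (-1)) ss.
by apply: (smooth_section_on_ext oU _ sN) => p _; rewrite scaleN1r.
Qed.

Lemma smooth_section_on_sum (I : Type) (q : seq I) (S : I -> section E) U :
  open U -> (forall i, smooth_section_on U (S i)) ->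
  smooth_section_on U (fun p => \sum_(i <- q) S i p).
Proof.
move=> oU sS; elim: q => [|i q IH].
  by apply: (smooth_section_on_ext oU _ (@smooth_section_on0 U)) => p _; rewrite big_nil.
apply: (smooth_section_on_ext oU _ (smooth_section_on_add oU (sS i) IH)) => p _.
by rewrite big_cons.
Qed.

Definition smooth_functional_on U (phi : forall p, E p -> R) : Prop :=
  forall e, frames e -> forall i : 'I_r,
    smooth_on (frame_dom e `&` U) (fun p => phi p (tnth (e p) i)).

Lemma smooth_functional_section U phi s : open U ->
  (forall p a (u w : E p), U p -> phi p (a *: u + w) = a * phi p u + phi p w) ->
  smooth_functional_on U phi -> smooth_section_on U s ->
  smooth_on U (fun p => phi p (s p)).
Proof.
move=> oU lin sphi ss; apply: smooth_on_local => p Up.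
have [e fe ep] := frames_cover E p; exists (frame_dom e `&` U) => //.
have oe := @frame_dom_open _ _ _ _ _ e.
have oeU : open (frame_dom e `&` U) by exact: openI.
apply: (@smooth_on_ext _ _ _ _ (fun p => \sum_(i < r)
    coord (e p) i (s p) * phi p (tnth (e p) i))) => //.
  move=> q [eq Uq]; rewrite [in RHS](frame_expand (s q) eq).
  by rewrite functional_sum// => a u w; exact: lin.
apply: smooth_on_sum => // i _; apply: smooth_on_mul => //; first exact: ss.
exact: sphi.
Qed.

Lemma smooth_form_functional U (b : forall p, E p -> E p -> R) t : open U ->
  (forall p (u : E p) a v w, b p u (a *: v + w) = a * b p u v + b p u w) ->
  smooth_form b -> smooth_section_on U t ->
  smooth_functional_on U (fun p u => b p u (t p)).
Proof.
move=> oU lin sb st e fe i.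
have oe := @frame_dom_open _ _ _ _ _ e.
have oeU : open (frame_dom e `&` U) by exact: openI.
apply: (@smooth_on_ext _ _ _ _ (fun p => \sum_(j < r)
    coord (e p) j (t p) * b p (tnth (e p) i) (tnth (e p) j))) => //.
  move=> q [eq Uq]; rewrite [in RHS](frame_expand (t q) eq).
  by rewrite functional_sum// => a u w; exact: lin.
apply: smooth_on_sum => // j _; apply: smooth_on_mul => //; first exact: st.
by apply: smooth_on_sub (sb e fe i j) => q [].
Qed.

Lemma smooth_endo_section U A s : open U -> smooth_endo A ->
  smooth_section_on U s -> smooth_section_on U (fun p => A p (s p)).
Proof.
move=> oU sA ss e fe i.
have oe := @frame_dom_open _ _ _ _ _ e.
have oeU : open (frame_dom e `&` U) by exact: openI.
apply: (@smooth_on_ext _ _ _ _ (fun p => \sum_(j < r)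
    coord (e p) j (s p) * coord (e p) i (A p (tnth (e p) j)))) => //.
  move=> q [eq Uq]; rewrite [in RHS](frame_expand (s q) eq).
  by rewrite !linear_sum/=; apply: eq_bigr => j _; rewrite !linearZ.
apply: smooth_on_sum => // j _; apply: smooth_on_mul => //; first exact: ss.
by apply: smooth_on_sub (sA e fe i j) => q [].
Qed.

Lemma smooth_endoI A :
  (forall e, frames e -> forall j, smooth_section_on (frame_dom e)
    (fun p => A p (tnth (e p) j))) -> smooth_endo A.
Proof.
by move=> sA e fe i j; have := sA e fe j e fe i; rewrite setIid.
Qed.

(* The coefficients of A v along the sections s_l solve a linear system with
   smooth coefficients, so Cramer's rule makes A smooth. *)
Lemma smooth_endo_solve A :
  (forall p, exists (U : set M) k (s : 'I_k -> section E)
      (phi psi : 'I_k -> forall q, E q -> R),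
    [/\ open U /\ U p,
        forall l, smooth_section_on U (s l),
        forall m, smooth_functional_on U (phi m) /\
          (forall q a (u w : E q), U q ->
            phi m q (a *: u + w) = a * phi m q u + phi m q w),
        (\matrix_(l < k, m < k) phi m p (s l p)) \in unitmx &
        forall q (v : E q), U q ->
          (exists c : 'I_k -> R, A q v = \sum_(l < k) c l *: s l q) /\
          forall m, phi m q (A q v) = psi m q v] /\
    (forall m, smooth_functional_on U (psi m))) ->
  smooth_endo A.
Proof.
move=> hA; apply: smooth_endoI => e fe j.
apply: smooth_section_on_local => p ep.
have [U [k [s [phi [psi [[[oU Up] ss sphi unitp Av] spsi]]]]]] := hA p.
pose B q := \matrix_(l < k, m < k) phi m q (s l q).
have sB l m : smooth_on U (fun q => B q l m).
  have [sp lp] := sphi m.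
  apply: (@smooth_on_ext _ _ _ _ (fun q => phi m q (s l q))) => //.
    by move=> q _; rewrite mxE.
  exact: smooth_functional_section.
have := smooth_on_neq0 oU Up (smooth_on_det oU sB).
rewrite -unitfE -unitmxE => /(_ unitp)[V [oV Vp VU Vd]].
have oe := @frame_dom_open _ _ _ _ _ e.
have oeV : open (frame_dom e `&` V) by exact: openI.
exists (frame_dom e `&` V) => //.
apply: (@smooth_section_on_ext _ (fun q => \sum_(l < k)
   (\sum_(m < k) psi m q (tnth (e q) j) * invmx (B q) m l) *: s l q)) => //.
  move=> q [eq Vq]; have [[c Ac] psiA] := Av q (tnth (e q) j) (VU _ Vq).
  rewrite Ac; apply: eq_bigr => l _; congr (_ *: _).
  have uB : B q \in unitmx by rewrite unitmxE unitfE; exact: Vd.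
  have -> : c l = (\row_l c l) 0 l by rewrite mxE.
  rewrite -[\row_l c l](mulmxK uB) mxE; apply: eq_bigr => m _.
  congr (_ * _); rewrite -psiA Ac mxE functional_sum; last first.
    by move=> a u w; apply: (sphi m).2; exact: VU.
  by apply: eq_bigr => l' _; rewrite !mxE.
apply: smooth_section_on_sum => // l; apply: smooth_section_on_scale => //.
  apply: smooth_on_sum => // m _; apply: smooth_on_mul => //.
    by apply: smooth_on_sub (spsi m e fe j) => q [eq Vq]; split=> //; exact: VU.
  apply: (@smooth_on_sub _ _ _ _ V) => [q []//|].
  apply: smooth_on_invmx => // [l' m'|q Vq]; first exact: smooth_on_sub (sB _ _).
  by rewrite unitmxE unitfE; exact: Vd.
by apply: smooth_section_on_sub (ss l) => q [_ /VU].
Qed.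

Lemma bump_section U p : open U -> U p -> exists f : M -> R,
  [/\ smooth f, f p = 1,
      forall q, ~ U q -> f q = 0,
      forall g, smooth_on U g -> smooth (fun q => f q * g q) &
      forall s, smooth_section_on U s -> smooth_section (fun q => f q *: s q)].
Proof.
move=> oU Up; have [f [C [sf fp clC CU fC]]] := bump_exists oU Up.
exists f; split=> // [q Uq|g sg|s ss].
    by apply: fC => /CU.
  by apply: (smooth_on_bump oU openT sf clC) => //; rewrite setTI.
move=> e fe i; have oe := @frame_dom_open _ _ _ _ _ e; rewrite setIT.
apply: (@smooth_on_ext _ _ _ _ (fun q => f q * coord (e q) i (s q))) => //.
  by move=> q _; rewrite linearZ.
by apply: (smooth_on_bump oU oe sf clC) => //; exact: ss.
Qed.

(** Allows a fibrewise identity to be tested on global sections. The coordinates of [v] are frozen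
    at [p] and a bump function extends the local section. *)
Lemma section_through p (v : E p) : exists2 s, smooth_section s & s p = v.
Proof.
have [e fe ep] := frames_cover E p.
have oe := @frame_dom_open _ _ _ _ _ e.
have [f [sf fp _ _ fs]] := bump_section oe ep.
exists (fun q => f q *: \sum_(i < r) coord (e p) i v *: tnth (e q) i).
  apply: fs; apply: smooth_section_on_sum => // i.
  apply: smooth_section_on_scale => //; first exact: smooth_on_cst.
  exact: smooth_section_on_frame.
by rewrite fp scale1r -frame_expand.
Qed.

End BundleSections.

(** * The ring of smooth functions and the module of smooth sections *)

Record smooth_function (R : realType) (n : nat) (M : manifold R n) :=
  SmoothFunction { sfun_val :> M -> R; sfun_smooth : smooth sfun_val }.

Record smooth_sec (R : realType) (n : nat) (M : manifold R n) (r : nat)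
    (E : vector_bundle M r) :=
  SmoothSec { ssec_val :> forall p, E p; ssec_smooth : smooth_section ssec_val }.

Section SmoothFunctionRing.
Variables (R : realType) (n : nat) (M : manifold R n).
Local Notation A := (smooth_function M).
Implicit Types f g h : A.

Lemma sfunP f g : (forall p, f p = g p) -> f = g.
Proof.
case: f g => f sf [g sg] /= fg; have e : f = g by exact/funext.
by case: _ / e sg => sg; congr SmoothFunction; exact: Prop_irrelevance.
Qed.

HB.instance Definition _ := gen_eqMixin A.
HB.instance Definition _ := gen_choiceMixin A.

Definition sfun_cst (c : R) : A := SmoothFunction (@smooth_on_cst R n M setT c).
Definition sfun_add f g : A :=
  SmoothFunction (smooth_on_add openT (sfun_smooth f) (sfun_smooth g)).
Definition sfun_opp f : A := SmoothFunction (smooth_on_opp openT (sfun_smooth f)).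
Definition sfun_mul f g : A :=
  SmoothFunction (smooth_on_mul openT (sfun_smooth f) (sfun_smooth g)).

Fact sfun_addA : associative sfun_add.
Proof. by move=> f g h; apply: sfunP => p; exact: addrA. Qed.
Fact sfun_addC : commutative sfun_add.
Proof. by move=> f g; apply: sfunP => p; exact: addrC. Qed.
Fact sfun_add0 : left_id (sfun_cst 0) sfun_add.
Proof. by move=> f; apply: sfunP => p; exact: add0r. Qed.
Fact sfun_addN : left_inverse (sfun_cst 0) sfun_opp sfun_add.
Proof. by move=> f; apply: sfunP => p; exact: addNr. Qed.
HB.instance Definition _ :=
  GRing.isZmodule.Build A sfun_addA sfun_addC sfun_add0 sfun_addN.

Fact sfun_mulA : associative sfun_mul.
Proof. by move=> f g h; apply: sfunP => p; exact: mulrA. Qed.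
Fact sfun_mulC : commutative sfun_mul.
Proof. by move=> f g; apply: sfunP => p; exact: mulrC. Qed.
Fact sfun_mul1 : left_id (sfun_cst 1) sfun_mul.
Proof. by move=> f; apply: sfunP => p; exact: mul1r. Qed.
Fact sfun_mulD : left_distributive sfun_mul +%R.
Proof. by move=> f g h; apply: sfunP => p; exact: mulrDl. Qed.
HB.instance Definition _ :=
  GRing.Zmodule_isComPzRing.Build A sfun_mulA sfun_mulC sfun_mul1 sfun_mulD.

End SmoothFunctionRing.

Section SmoothSectionModule.
Variables (R : realType) (n : nat) (M : manifold R n) (r : nat).
Variable E : vector_bundle M r.
Local Notation A := (smooth_function M).
Local Notation G := (smooth_sec E).
Implicit Types (x y z : G) (f g : A).

Lemma ssecP x y : (forall p, x p = y p) -> x = y.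
Proof.
case: x y => x sx [y sy] /= xy.
have e : x = y by exact: functional_extensionality_dep.
by case: _ / e sy => sy; congr SmoothSec; exact: Prop_irrelevance.
Qed.

HB.instance Definition _ := gen_eqMixin G.
HB.instance Definition _ := gen_choiceMixin G.

Definition ssec_zero : G := SmoothSec (@smooth_section_on0 R n M r E setT).
Definition ssec_add x y : G :=
  SmoothSec (smooth_section_on_add openT (ssec_smooth x) (ssec_smooth y)).
Definition ssec_scale f x : G :=
  SmoothSec (smooth_section_on_scale openT (sfun_smooth f) (ssec_smooth x)).
Definition ssec_opp x : G := SmoothSec (smooth_section_on_opp openT (ssec_smooth x)).

Fact ssec_addA : associative ssec_add.
Proof. by move=> x y z; apply: ssecP => p; exact: addrA. Qed.
Fact ssec_addC : commutative ssec_add.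
Proof. by move=> x y; apply: ssecP => p; exact: addrC. Qed.
Fact ssec_add0 : left_id ssec_zero ssec_add.
Proof. by move=> x; apply: ssecP => p; exact: add0r. Qed.
Fact ssec_addN : left_inverse ssec_zero ssec_opp ssec_add.
Proof. by move=> x; apply: ssecP => p; exact: addNr. Qed.
HB.instance Definition _ :=
  GRing.isZmodule.Build G ssec_addA ssec_addC ssec_add0 ssec_addN.

Fact ssec_scaleA f g x : ssec_scale f (ssec_scale g x) = ssec_scale (f * g) x.
Proof. by apply: ssecP => p; exact: scalerA. Qed.
Fact ssec_scale1 : left_id 1 ssec_scale.
Proof. by move=> x; apply: ssecP => p; exact: scale1r. Qed.
Fact ssec_scaleDr : right_distributive ssec_scale +%R.
Proof. by move=> f x y; apply: ssecP => p; exact: scalerDr. Qed.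
Fact ssec_scaleDl x : {morph ssec_scale^~ x : f g / f + g}.
Proof. by move=> f g; apply: ssecP => p; exact: scalerDl. Qed.
HB.instance Definition _ := GRing.Zmodule_isLmodule.Build A G
  ssec_scaleA ssec_scale1 ssec_scaleDr ssec_scaleDl.

Lemma ssec_through p (v : E p) : exists x, x p = v.
Proof. by have [s ss <-] := section_through v; exists (SmoothSec ss). Qed.

Definition ssec_endo (B : endo E) (sB : smooth_endo B) x : G :=
  SmoothSec (smooth_endo_section openT sB (ssec_smooth x)).

Lemma ssec_endoD (B : endo E) (sB : smooth_endo B) x y :
  ssec_endo sB (x + y) = ssec_endo sB x + ssec_endo sB y.
Proof. by apply: ssecP => p; exact: linearD. Qed.

Lemma ssec_endoZ (B : endo E) (sB : smooth_endo B) f x :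
  ssec_endo sB (f *: x) = f *: ssec_endo sB x.
Proof. by apply: ssecP => p; exact: linearZ. Qed.

End SmoothSectionModule.

Section CourantSections.
Variables (R : realType) (n : nat) (M : manifold R n) (r : nat).
Variable E : courant_algebroid M r.
Local Notation A := (smooth_function M).
Local Notation G := (smooth_sec E).
Implicit Types (x y z : G) (f g : A).

Lemma smooth_scalar x y : smooth (fun p => Defs.scalar E p (x p) (y p)).
Proof.
apply: (@smooth_functional_section _ _ _ _ _ setT (fun p u => Defs.scalar E p u (y p))) => //.
- exact: openT.
- by move=> p a u w _; rewrite !(symmetricC _ _ (y p)) linearP.
- apply: (@smooth_form_functional _ _ _ _ _ setT (fun p => Defs.scalar E p)) => //.
  + exact: openT.
  + by move=> p u a v w; rewrite linearP.
  + exact: scalar_smooth.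
  + exact: ssec_smooth.
- exact: ssec_smooth.
Qed.

Lemma anchor_functional (g : M -> R) : smooth g -> smooth_functional_on setT
  (fun p (u : E p) => anchor u g).
Proof.
by move=> sg e fe i; apply: smooth_on_sub (anchor_smooth fe i sg) => p [].
Qed.

Lemma smooth_anchor x f : smooth (fun p => anchor (x p) f).
Proof.
have sf := sfun_smooth f.
apply: (@smooth_functional_section _ _ _ _ _ setT (fun p u => anchor u f)) => //.
- exact: openT.
- by move=> p a u w _; exact: anchor_linear.
- exact: anchor_functional.
- exact: ssec_smooth.
Qed.

Lemma anchor0 p (f : M -> R) : smooth f -> anchor (0 : E p) f = 0.
Proof.
move=> sf; have := @anchor_linear _ _ _ _ E p 1 0 0 f sf.
by rewrite scaler0 addr0 mul1r => /esym/eqP; rewrite -subr_eq0 addrK => /eqP.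
Qed.

Definition ssec_bracket x y : G :=
  SmoothSec (bracket_smooth (ssec_smooth x) (ssec_smooth y)).

(** Ended by [Defined], so that evaluation at a point unfolds by conversion to the operations of the
    algebroid. *)
Definition courant_sections : courant_dorfman G.
Proof.
refine (@CourantDorfman A G (sfun_cst M 2^-1)
  (fun x y => SmoothFunction (smooth_scalar x y))
  (fun x f => SmoothFunction (smooth_anchor x f)) ssec_bracket
  _ _ _ _ _ _ _ _ _ _ _ _ _ _ _).
- by apply: sfunP => p /=; rewrite -[2^-1]mul1r -splitr.
- by move=> x y; apply: sfunP => p; exact: symmetricC.
- move=> x y z; apply: sfunP => p /=.
  by rewrite !(symmetricC _ _ (z p)) linearD.
- move=> f x z; apply: sfunP => p /=.
  by rewrite !(symmetricC _ _ (z p)) linearZ.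
- move=> x x0; apply: ssecP => p.
  apply: (nondegenerate_eq0 (scalar_nondegenerate E p)) => v.
  have [z <-] := ssec_through v.
  exact: (congr1 (fun f : A => f p) (x0 z)).
- move=> x y f; apply: sfunP => p /=.
  by have := @anchor_linear _ _ _ _ E p 1 (x p) (y p) f (sfun_smooth f); rewrite scale1r mul1r.
- move=> f x g; apply: sfunP => p /=.
  have := @anchor_linear _ _ _ _ E p (f p) (x p) 0 g (sfun_smooth g).
  by rewrite addr0 anchor0 ?addr0//; exact: sfun_smooth.
- move=> x f g; apply: sfunP => p /=.
  have := tangent_linear (anchor (x p)) 1 (sfun_smooth f) (sfun_smooth g).
  rewrite mul1r => <-.
  by congr (tangent_fun _ _); apply/funext => q; rewrite mul1r.
- move=> x f g; apply: sfunP => p.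
  exact: (tangent_leibniz (anchor (x p)) (sfun_smooth f) (sfun_smooth g)).
- move=> x y z; apply: ssecP => p /=.
  have := bracket_linearl 1 (ssec_smooth x) (ssec_smooth y) (ssec_smooth z) p.
  rewrite scale1r => <-.
  congr (bracket _ _ p); apply: functional_extensionality_dep => q.
  by rewrite scale1r.
- move=> x y z; apply: ssecP => p /=.
  have := bracket_linearr 1 (ssec_smooth y) (ssec_smooth z) (ssec_smooth x) p.
  rewrite scale1r => <-.
  congr (bracket _ _ p); apply: functional_extensionality_dep => q.
  by rewrite scale1r.
- move=> x f y; apply: ssecP => p.
  exact: (bracket_leibniz (ssec_smooth x) (ssec_smooth y) (sfun_smooth f)).
- move=> x y z; apply: ssecP => p.
  exact: (bracket_jacobi (ssec_smooth x) (ssec_smooth y) (ssec_smooth z)).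
- move=> x y z; apply: sfunP => p.
  exact: (bracket_metric (ssec_smooth x) (ssec_smooth y) (ssec_smooth z)).
- move=> x y z; apply: sfunP => p.
  exact: (bracket_sym (ssec_smooth x) (ssec_smooth y) (ssec_smooth z)).
Defined.

End CourantSections.

Section TensorialEndo.
Variables (R : realType) (n : nat) (M : manifold R n) (r : nat).
Variable E : vector_bundle M r.
Local Notation A := (smooth_function M).
Local Notation G := (smooth_sec E).

Lemma ssec_sumE (I : Type) (q : seq I) (S : I -> G) p :
  (\sum_(i <- q) S i) p = \sum_(i <- q) S i p.
Proof. by elim/big_ind2: _ => // x v y w <- <-. Qed.

(** Linearity over smooth functions makes the value at [p] depend on the argument at [p] only. The
    frames and bumps are chosen point by point without any continuity, so smoothness needs a
    separate argument. *)
Lemma tensorial_endo (Phi : G -> G) :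
  {morph Phi : x y / x + y} ->
  (forall (f : A) x, Phi (f *: x) = f *: Phi x) ->
  exists2 B : endo E, smooth_endo B & forall (x : G) p, B p (x p) = Phi x p.
Proof.
move=> PhiD PhiZ.
have Phi0 : Phi 0 = 0 by rewrite -[X in Phi X](scale0r (0 : G)) PhiZ scale0r.
have he0 (p : M) : exists e : local_frame r E, frames e /\ frame_dom e p.
  by have [e fe ep] := frames_cover E p; exists e.
have [e he] := choice he0.
have hf0 (p : M) : exists f : A, [/\ f p = 1,
    forall q, ~ frame_dom (e p) q -> f q = 0,
    forall g, smooth_on (frame_dom (e p)) g -> smooth (fun q => f q * g q) &
    forall s : section E, smooth_section_on (frame_dom (e p)) s ->
      smooth_section (fun q => f q *: s q)].
  have oe := @frame_dom_open _ _ _ _ _ (e p).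
  have [f [sf fp f0 fg fs]] := bump_section E oe (he p).2.
  by exists (SmoothFunction sf).
have [f hf] := choice hf0.
have sb p j : smooth_section (fun q => f p q *: tnth (e p q) j).
  by have [_ _ _] := hf p; apply; apply: smooth_section_on_frame; exact: (he p).1.
pose b p j : G := SmoothSec (sb p j).
pose B0 p (v : E p) : E p := \sum_(j < r) coord (e p p) j v *: Phi (b p j) p.
have lB0 p : linear (B0 p).
  move=> a u v; rewrite /B0 scaler_sumr -big_split; apply: eq_bigr => j _ /=.
  by rewrite linearP scalerDl scalerA.
pose B : endo E := fun p => projT1 (cid (linear_hom (lB0 p))).
have hB p v : B p v = B0 p v by rewrite /B; case: cid.
have BE (x : G) p : B p (x p) = Phi x p.
  rewrite hB /B0; have [fp f0 fg fs] := hf p; have [fe ep] := he p.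
  have sc j : smooth (fun q => f p q * coord (e p q) j (x q)).
    by apply: fg; have := ssec_smooth x fe j; rewrite setIT.
  pose c j : A := SmoothFunction (sc j).
  (* The bump is squared: coefficients and frame sections each need one copy in order to be globally
     smooth. *)
  have cb : \sum_(j < r) c j *: b p j = (f p * f p) *: x.
    apply: ssecP => q; rewrite ssec_sumE /=.
    have [eq|neq] := pselect (frame_dom (e p) q).
      rewrite [in RHS](frame_expand (x q) eq) scaler_sumr; apply: eq_bigr => j _.
      by rewrite /= !scalerA; congr (_ *: _); ring.
    rewrite big1 => [|j _]; last by rewrite f0// mul0r scale0r.
    by rewrite f0// mul0r scale0r.
  have := congr1 (fun y : G => y p) (congr1 Phi cb).
  rewrite PhiZ (big_morph Phi PhiD Phi0) ssec_sumE /= fp mul1r scale1r => <-.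
  by apply: eq_bigr => j _; rewrite PhiZ /= fp mul1r.
exists B => //; apply: smooth_endoI => e' fe' j.
apply: smooth_section_on_local => p ep.
have oe := @frame_dom_open _ _ _ _ _ e'.
have [g [sg gp _ gg gs]] := bump_section E oe ep.
have g1 : g p != 0 by rewrite gp oner_eq0.
have [V [oV Vp _ Vg]] := smooth_on_neq0 openT I sg g1.
exists V => //.
(* Where [g] is nonzero, [B] sends the frame section to [Phi t] divided by [g], which is smooth. *)
pose t : G := SmoothSec (gs _ (smooth_section_on_frame j fe')).
apply: (@smooth_section_on_ext _ _ _ _ _ _ (fun q => (g q)^-1 *: Phi t q)) => //.
  by move=> q Vq; rewrite -BE linearZ/= scalerA mulVf ?scale1r//; exact: Vg.
apply: smooth_section_on_scale => //.
  by apply: smooth_on_inv => //; exact: smooth_onT.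
by apply: smooth_section_onT; exact: ssec_smooth.
Qed.

End TensorialEndo.

(** * Smoothness of G^end, of the lift to E- and of its adjoint *)

Section GeneralizedMetricSections.
Variables (R : realType) (n : nat) (M : manifold R n) (r : nat).
Variables (E : courant_algebroid M r) (Em : forall p, {vspace E p}).
Hypothesis gm : generalized_metric Em.
Local Notation b := (Defs.scalar E _).
Local Notation G := (smooth_sec E).

Definition independent p k (s : 'I_k -> E p) :=
  forall c : 'I_k -> R, \sum_l c l *: s l = 0 -> forall l, c l = 0.

Lemma basis_independent p (W : {vspace E p}) k (s : k.-tuple (E p)) :
  basis_of W s -> [/\ forall l, tnth s l \in W, independent (tnth s) &
    forall w, w \in W -> exists c : 'I_k -> R, w = \sum_l c l *: tnth s l].
Proof.
move=> bs; split.
- by move=> l; apply: (basis_mem bs); exact: mem_tnth.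
- move=> c e l; have /freeP := basis_free bs; apply.
  by rewrite -[RHS]e; apply: eq_bigr => i _; rewrite (tnth_nth 0).
- move=> w wW; exists (fun l => coord s l w); rewrite {1}(coord_basis bs wW).
  by apply: eq_bigr => i _; rewrite (tnth_nth 0).
Qed.

Lemma Em_frame p : exists (U : set M) k (s : 'I_k -> section E),
  [/\ open U, U p, forall l, smooth_section_on U (s l) &
    forall q, U q -> [/\ forall l, s l q \in Em q, independent (s^~ q) &
    forall w, w \in Em q -> exists c : 'I_k -> R, w = \sum_l c l *: s l q]].
Proof.
have [k [U [s [oU Up ss bs]]]] := gm_subbundle gm p.
exists U, k, (fun l q => tnth (s q) l); split=> // q Uq.
exact: basis_independent (bs q Uq).
Qed.

Lemma scalarPl p a (u w v : E p) : b (a *: u + w) v = a * b u v + b w v.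
Proof. by rewrite !(symmetricC _ _ v) linearP. Qed.

Lemma scalarDl p (u w v : E p) : b (u + w) v = b u v + b w v.
Proof. by rewrite !(symmetricC _ _ v) linearD. Qed.

Lemma scalarBl p (u w v : E p) : b (u - w) v = b u v - b w v.
Proof. by rewrite !(symmetricC _ _ v) linearB. Qed.

(** The component in E- is found from its pairings with a frame of E-, whose Gram matrix is
    invertible by nondegeneracy. *)
Lemma Em_decomp p (v : E p) : exists2 w, w \in Em p & v - w \in Eplus Em p.
Proof.
have [U [k [s [oU Up ss /(_ p Up)[sW fr sp]]]]] := Em_frame p.
have uG := gram_unit sW fr sp (gm_nondegenerate gm (p := p)).
have [|c hc] := @linear_system_solve _ _ _ (s^~ p) (fun m u => b u (s m p))
    (fun m => b v (s m p)) _ uG.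
  by move=> i a u w; exact: scalarPl.
exists (\sum_l c l *: s l p).
  by apply: memv_suml => l _; rewrite memvZ.
apply/mem_orthovP => w /sp[d ->]; rewrite linear_sum big1// => m _.
rewrite linearZ /= -[- _]scaleN1r addrC scalarPl hc mulN1r addNr mulr0 //.
Qed.

Lemma Gend_decomp p (w v : E p) : w \in Em p -> v \in Eplus Em p ->
  Gend Em p (v + w) = v - w.
Proof.
by move=> wE vE; have [Gp Gm] := GendE p gm; rewrite linearD /= Gp// Gm.
Qed.

Lemma Em_decomp_sum p (v : E p) : exists u w,
  [/\ w \in Em p, u \in Eplus Em p & v = u + w].
Proof.
by have [w wE vw] := Em_decomp v; exists (v - w), w; split=> //; rewrite subrK.
Qed.

Lemma Eplus_ip p (u w : E p) : u \in Eplus Em p -> w \in Em p -> b u w = 0.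
Proof. by move=> /mem_orthovP + wE; apply. Qed.

Lemma Gend_invol p (v : E p) : Gend Em p (Gend Em p v) = v.
Proof.
have [u [w [wE uE ->]]] := Em_decomp_sum v.
by rewrite Gend_decomp// Gend_decomp ?memvN// opprK.
Qed.

Lemma Gend_sym p (v v' : E p) : b (Gend Em p v) v' = b v (Gend Em p v').
Proof.
have [u [w [wE uE ->]]] := Em_decomp_sum v.
have [u' [w' [wE' uE' ->]]] := Em_decomp_sum v'.
rewrite !Gend_decomp// -[- w]scaleN1r -[- w']scaleN1r.
rewrite !linearD /= !linearZ /= !(symmetricC _ (_ + _)) !linearD /= !linearZ /=.
by rewrite (symmetricC _ w' u) (Eplus_ip uE wE') (Eplus_ip uE' wE); ring.
Qed.

Lemma Gend_Em p (v : E p) : (Gend Em p v = - v) <-> v \in Em p.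
Proof.
split=> [|vE]; last by have [_ ->] := GendE p gm.
have [u [w [wE uE ->]]] := Em_decomp_sum v; rewrite Gend_decomp// opprD.
move=> /addIr e; have u0 : u = 0.
  have : (2 : R) *: u = 0 by rewrite scaler_nat mulr2n {1}e addNr.
  by move=> /eqP; rewrite scaler_eq0 pnatr_eq0 => /eqP.
by rewrite u0 add0r.
Qed.

Lemma frame_functional e m : frames e -> smooth_functional_on (frame_dom e)
  (fun q (u : E q) => b u (tnth (e q) m)).
Proof.
move=> fe; apply: (@smooth_form_functional _ _ _ _ _ _ (fun q => Defs.scalar E q)).
- exact: frame_dom_open.
- by move=> p u a v w; rewrite linearP.
- exact: scalar_smooth.
- exact: smooth_section_on_frame.
Qed.

(** G^end is 1 - 2B with [B] the projection onto E-; B v is determined by having the same pairings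
    as [v] with a local frame of E-. *)
Lemma smooth_Gend : smooth_endo (Gend Em).
Proof.
pose B p : 'End(E p) := 2^-1 *: (\1%VF - Gend Em p).
have BE p (u w : E p) : w \in Em p -> u \in Eplus Em p -> B p (u + w) = w.
  move=> wE uE; rewrite /B scale_lfunE add_lfunE opp_lfunE id_lfunE Gend_decomp//.
  rewrite opprB [u + w]addrC addrACA subrr addr0.
  by rewrite scalerDr -scalerDl -[2^-1]mul1r -splitr scale1r.
have sB : smooth_endo B.
  apply: smooth_endo_solve => p.
  have [U [k [s [oU Up ss hs]]]] := Em_frame p.
  exists U, k, s, (fun m q u => b u (s m q)), (fun m q u => b u (s m q)).
  have sphi m : smooth_functional_on U (fun q (u : E q) => b u (s m q)).
    apply: (@smooth_form_functional _ _ _ _ _ _ (fun q => Defs.scalar E q)) => //;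
      last exact: scalar_smooth.
    by move=> q u a v w; rewrite linearP.
  split=> //; split=> //.
  - by move=> m; split=> // q a u w _; exact: scalarPl.
  - by have [sW fr sp] := hs p Up; exact: gram_unit sW fr sp (gm_nondegenerate gm (p := p)).
  - move=> q v Uq; have [sW fr sp] := hs q Uq.
    have [u [w [wE uE ->]]] := Em_decomp_sum v; rewrite BE//; split; first exact: sp.
    by move=> m; rewrite scalarDl (Eplus_ip uE (sW m)) add0r.
apply: smooth_endoI => e fe j; have oe := @frame_dom_open _ _ _ _ _ e.
have se := smooth_section_on_frame j fe.
apply: (@smooth_section_on_ext _ _ _ _ _ _
    (fun p => tnth (e p) j + (-2) *: B p (tnth (e p) j))) => //; last first.
  apply: smooth_section_on_add => //; apply: smooth_section_on_scale => //.
    exact: smooth_on_cst.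
  exact: smooth_endo_section.
move=> p _ /=; have [u [w [wE uE ->]]] := Em_decomp_sum (tnth (e p) j).
rewrite BE// Gend_decomp// scaleNr scaler_nat mulr2n opprD addrA.
by rewrite addrK.
Qed.

Lemma lift_exists p : exists B : 'End(E p), forall v : E p,
  B v \in Em p /\ tangent_eq (anchor (B v)) (anchor v).
Proof.
have h (v : E p) : exists u, u \in Em p /\ tangent_eq (anchor u) (anchor v).
  by have [u uE uv] := gm_anchor_surj gm (anchor v); exists u.
have [f hf] := choice h.
have lf : linear f.
  move=> a u v; apply: (gm_anchor_inj gm); first exact: (hf _).1.
    by rewrite memvD ?memvZ ?(hf _).1.
  by move=> g sg; rewrite (hf _).2// !anchor_linear// !(hf _).2.
by have [B BE] := linear_hom lf; exists B => v; rewrite BE.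
Qed.

(** The lift is determined by its action on all smooth functions. As the anchor is injective on E-,
    finitely many of them already determine it at [p], and by continuity of the determinant near
    [p]. *)
Lemma smooth_lift_exists : exists2 a : endo E, smooth_endo a &
  forall p (v : E p), a p v \in Em p /\ tangent_eq (anchor (a p v)) (anchor v).
Proof.
pose a : endo E := fun p => projT1 (cid (lift_exists p)).
have ha p v : a p v \in Em p /\ tangent_eq (anchor (a p v)) (anchor v).
  by rewrite /a; case: cid.
exists a => //; apply: smooth_endo_solve => p.
have [U [k [s [oU Up ss hs]]]] := Em_frame p.
have [sW fr sp] := hs p Up.
have [||f uf] := @linear_separating_unit _ _ (smooth_function M) _ (s^~ p)
    (fun f u => anchor u f).
- by move=> f c u w; apply: anchor_linear; exact: sfun_smooth.
- move=> c hc; apply: fr; apply: (gm_anchor_inj gm).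
  + by apply: memv_suml => l _; rewrite memvZ.
  + exact: mem0v.
  + by move=> g sg; rewrite anchor0// (hc (SmoothFunction sg)).
have sphi m : smooth_functional_on U (fun q (u : E q) => anchor u (f m)).
  move=> e fe i; apply: smooth_on_sub (anchor_smooth fe i (sfun_smooth (f m))).
  by move=> q [].
exists U, k, s, (fun m q u => anchor u (f m)), (fun m q u => anchor u (f m)).
split=> //; split=> //.
- by move=> m; split=> // q c u w _; apply: anchor_linear; exact: sfun_smooth.
- move=> q v Uq; have [aE ta] := ha q v; split.
    by have [_ _ ] := hs q Uq; apply.
  by move=> m; apply: ta; exact: sfun_smooth.
Qed.

Lemma smooth_adjoint_exists (a : endo E) : smooth_endo a ->
  exists2 a' : endo E, smooth_endo a' &
    forall p (u v : E p), b (a p u) v = b u (a' p v).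
Proof.
move=> sa.
have bnd p (u : E p) : u \in fullv -> (forall v, v \in fullv -> b u v = 0) -> u = 0.
  move=> _ h; apply: (nondegenerate_eq0 (scalar_nondegenerate E p)) => v.
  by apply: h; exact: memvf.
have unit p e : frame_dom e p ->
    \matrix_(l < r, m < r) b (tnth (e p) l) (tnth (e p) m) \in unitmx.
  move=> ep; have [sW fr sp] := basis_independent (frame_basis ep).
  exact: (gram_unit sW fr sp (@bnd p)).
have adj p : exists B : 'End(E p), forall u v, b (a p u) v = b u (B v).
  have [e fe ep] := frames_cover E p.
  have h v : exists w, forall u, b w u = b v (a p u).
    have [|c hc] := @linear_system_solve _ _ _ (tnth (e p))
      (fun m u => b u (tnth (e p) m)) (fun m => b v (a p (tnth (e p) m))) _ (unit p e ep).
      by move=> i c u w; exact: scalarPl.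
    exists (\sum_l c l *: tnth (e p) l) => u.
    rewrite (frame_expand u ep) !linear_sum; apply: eq_bigr => m _.
    by rewrite !linearZ /= hc.
  have [f hf] := choice h.
  have lf : linear f.
    move=> c u v; apply/eqP; rewrite -subr_eq0; apply/eqP.
    apply: (nondegenerate_eq0 (scalar_nondegenerate E p)) => w.
    by rewrite scalarBl hf !scalarPl !hf subrr.
  have [B BE] := linear_hom lf; exists B => u v.
  by rewrite BE [RHS]symmetricC hf symmetricC.
pose a' : endo E := fun p => projT1 (cid (adj p)).
have ha p u v : b (a p u) v = b u (a' p v) by rewrite /a'; case: cid.
exists a' => //; apply: smooth_endo_solve => p.
have [e fe ep] := frames_cover E p; have oe := @frame_dom_open _ _ _ _ _ e.
exists (frame_dom e), r, (fun l q => tnth (e q) l),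
  (fun m q u => b u (tnth (e q) m)), (fun m q u => b u (a q (tnth (e q) m))).
split; last first.
  move=> m; apply: (@smooth_form_functional _ _ _ _ _ _ (fun q => Defs.scalar E q)) => //.
  - by move=> q u c v w; rewrite linearP.
  - exact: scalar_smooth.
  - by apply: smooth_endo_section => //; exact: smooth_section_on_frame.
split=> //.
- by move=> l; exact: smooth_section_on_frame.
- by move=> m; split; [exact: frame_functional|move=> q c u w _; exact: scalarPl].
- exact: unit.
- move=> q v eq; split; last by move=> m; rewrite symmetricC -ha symmetricC.
  by exists (fun l => coord (e q) l (a' q v)); exact: frame_expand.
Qed.

End GeneralizedMetricSections.

(** * From Courant algebroids to Courant-Dorfman algebras *)

Section Correspondence.
Variables (R : realType) (n : nat) (M : manifold R n) (r : nat).
Variable E : courant_algebroid M r.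
Local Notation A := (smooth_function M).
Local Notation G := (smooth_sec E).
Local Notation C := (courant_sections E).
Local Notation b := (Defs.scalar E _).

Lemma tangent_cst p (X : tangent p) (c : R) : X (fun _ : M => c) = 0.
Proof.
have s1 : smooth (fun _ : M => 1 : R) by exact: smooth_on_cst.
have X1 : X (fun _ : M => 1) = 0.
  have := tangent_leibniz X s1 s1; rewrite mul1r mulr1 mul1r.
  by move=> /eqP; rewrite -subr_eq0 opprD addrA subrr sub0r oppr_eq0 => /eqP.
have := tangent_linear X (c - 1) s1 s1.
rewrite X1 mulr0 addr0 => <-; congr (tangent_fun X _); apply/funext => q.
by rewrite mulr1 subrK.
Qed.

Lemma smooth_endo_comp (B B' : endo E) : smooth_endo B -> smooth_endo B' ->
  smooth_endo (fun p => (B p \o B' p)%VF).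
Proof.
move=> sB sB'; apply: smooth_endoI => e fe j; have oe := @frame_dom_open _ _ _ _ _ e.
apply: (@smooth_section_on_ext _ _ _ _ _ _ (fun p => B p (B' p (tnth (e p) j)))) => //.
  by move=> p _; rewrite comp_lfunE.
apply: smooth_endo_section => //; apply: smooth_endo_section => //.
exact: smooth_section_on_frame.
Qed.

Lemma ssec_endo_comp (B B' : endo E) (sB : smooth_endo B) (sB' : smooth_endo B') :
  ssec_endo (smooth_endo_comp sB sB') = fun x => ssec_endo sB (ssec_endo sB' x).
Proof. by apply/funext => x; apply: ssecP => p /=; rewrite comp_lfunE. Qed.

(** The i-eigensections are exactly the v - iJv with [v] orthogonal to [u]; their real parts are
    images of [J]. *)
Lemma integrable_closed (J : endo E) (sJ : smooth_endo J) (u : G) (eps : A) :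
  almost_complex C (ssec_endo sJ) u eps ->
  Defs.integrable J <-> closed_eigenbundle C (ssec_endo sJ) u.
Proof.
move=> acJ; pose F := ssec_endo sJ; split=> [intJ x y xu yu|clJ z w [sz sz'] [sw sw'] Jz Jw].
  pose z (v : G) : csection E := fun p => (v p, (- F v) p).
  have sz v : smooth_csection (z v).
    by split; [exact: (ssec_smooth v)|exact: (ssec_smooth (- F v))].
  have Jz v : cd_ip C v u = 0 -> in_i_eigenbundle J (z v).
    move=> vu p; rewrite /cendo /mul_i /=.
    have FF := ac_sqr_perp acJ vu; have FN := acN acJ (F v).
    congr pair; first by rewrite -[RHS]/((- - F v) p) opprK.
    by rewrite -[LHS]/(ssec_endo sJ (- F v) p) FN /F FF opprK.
  apply: ssecP => p.
  have := congr1 fst (intJ _ _ (sz x) (sz y) (Jz _ xu) (Jz _ yu) p).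
  rewrite /cendo /mul_i /=.
  rewrite -[LHS]/(F (cd_br C x y - cd_br C (- F x) (- F y)) p).
  rewrite -[RHS]/((- (cd_br C x (- F y) + cd_br C (- F x) y)) p).
  by rewrite !brNl !brNr !opprK -opprD opprK.
pose x : G := SmoothSec sz; pose x' : G := SmoothSec sz'.
pose y : G := SmoothSec sw; pose y' : G := SmoothSec sw'.
have E1 : F x = - x' by apply: ssecP => p; have := congr1 fst (Jz p).
have E2 : F x' = x by apply: ssecP => p; have := congr1 snd (Jz p).
have E3 : F y = - y' by apply: ssecP => p; have := congr1 fst (Jw p).
have E4 : F y' = y by apply: ssecP => p; have := congr1 snd (Jw p).
have xu : cd_ip C x u = 0 by rewrite -E2; exact: (ac_ip acJ).
have yu : cd_ip C y u = 0 by rewrite -E4; exact: (ac_ip acJ).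
have Fyu : cd_ip C (F y) u = 0 by exact: (ac_ip acJ).
(* The identity for [x], [y] is the real component of the eigenvector equation; the one for [x],
   [F y] is the imaginary component. *)
have c1 := clJ x y xu yu; have c2 := clJ x (F y) xu Fyu.
move=> p; rewrite /cendo /mul_i; congr pair.
  rewrite -[LHS]/(F (cd_br C x y - cd_br C x' y') p).
  rewrite -[RHS]/((- (cd_br C x y' + cd_br C x' y)) p); congr (ssec_val _ p).
  move: c1; rewrite -/F E1 E3 !brNl !brNr !opprK => ->.
  by rewrite opprD.
rewrite -[LHS]/(F (cd_br C x y' + cd_br C x' y) p).
rewrite -[RHS]/((cd_br C x y - cd_br C x' y') p); congr (ssec_val _ p).
move: c2; rewrite /F (ac_sqr_perp acJ yu) -/F E1 E3 !brNl !brNr !opprK => c2.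
have e := acN acJ (cd_br C x y' + cd_br C x' y).
move: e; rewrite -/F opprD c2 => e; rewrite -[LHS]opprK -e.
by rewrite opprD opprK.
Qed.

Lemma almost_complex_ssec (F : endo E) : Bn_almost_complex F ->
  forall sF : smooth_endo F, exists (u : G) (eps : A), almost_complex C (ssec_endo sF) u eps.
Proof.
move=> acF sF; have [u0 [su0 uu sq]] := Bn_square acF.
exists (SmoothSec su0), (sfun_cst M ((-1) ^+ n)); split.
- split.
  + by move=> x; apply: sfunP => p; exact: tangent_cst.
  + by apply: sfunP => p /=; rewrite -exprMn mulrNN mulr1 expr1n.
  + by apply: sfunP => p /=; exact: uu.
- exact: ssec_endoD.
- exact: ssec_endoZ.
- by move=> x y; apply: sfunP => p; exact: (Bn_skew acF).
- by move=> x; apply: ssecP => p; exact: sq.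
Qed.

Lemma involution_ssec (Em : forall p, {vspace E p}) (gm : generalized_metric Em) :
  involution C (ssec_endo (smooth_Gend gm)).
Proof.
split.
- exact: ssec_endoD.
- exact: ssec_endoZ.
- by move=> x y; apply: sfunP => p; exact: Gend_sym.
- by move=> x; apply: ssecP => p; exact: Gend_invol.
Qed.

Definition conn_ssec (D : connection_op E) (gc : generalized_connection D) (w x : G) : G :=
  ssec_endo (gc_smooth gc (ssec_smooth x)) w.

Lemma connection_ssec (D : connection_op E) (gc : generalized_connection D) :
  connection C (conn_ssec gc).
Proof.
split.
- by move=> w w' x; apply: ssecP => p; exact: linearD.
- by move=> f w x; apply: ssecP => p; exact: linearZ.
- move=> w x y; apply: ssecP => p /=.
  have := gc_linear gc 1 (ssec_smooth x) (ssec_smooth y) p.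
  rewrite scale1r => /(congr1 (fun B : 'End(E p) => B (w p))).
  rewrite add_lfunE => <-; congr (D _ p (w p)).
  by apply: functional_extensionality_dep => q; rewrite scale1r.
- move=> w f x; apply: ssecP => p.
  exact: (gc_leibniz gc (ssec_smooth w) (ssec_smooth x) (sfun_smooth f)).
- move=> w x y; apply: sfunP => p.
  exact: (gc_metric gc (ssec_smooth w) (ssec_smooth x) (ssec_smooth y)).
Qed.

Lemma connection_of_ssec (D : G -> G -> G) : connection C D ->
  exists2 D' : connection_op E, generalized_connection D' &
    forall (w x : G) p, cov D' w x p = D w x p.
Proof.
move=> cD.
have h (x : G) : exists B : endo E, smooth_endo B /\ forall (w : G) p, B p (w p) = D w x p.
  have [|f w|B sB BE] := @tensorial_endo _ _ _ _ _ (D^~ x).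
  - by move=> w w'; exact: (con_Dl cD).
  - exact: (con_Zl cD).
  - by exists B.
have [B hB] := choice h.
(* Zero on sections that are not smooth is a mere default, a generalized connection being
   constrained on smooth ones only. *)
pose D' : connection_op E := fun s =>
  if pselect (smooth_section s) is left ss then B (SmoothSec ss) else fun p => 0.
have D'B (x : G) : D' x = B x.
  rewrite /D'; case: pselect => [ss|]; last by move/(_ (ssec_smooth x)).
  by congr (B _); exact: ssecP.
have D'E (w x : G) p : cov D' w x p = D w x p by rewrite /cov D'B (hB x).2.
exists D' => //; split.
- by move=> s ss; rewrite -[s]/(ssec_val (SmoothSec ss)) D'B; exact: (hB _).1.
- move=> a s t ss st p; apply/lfunP => v.
  have [w <-] := ssec_through v.
  pose x : G := SmoothSec ss; pose y : G := SmoothSec st.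
  rewrite add_lfunE scale_lfunE.
  rewrite -[LHS]/(cov D' w (sfun_cst M a *: x + y) p).
  rewrite -[RHS]/(a *: cov D' w x p + cov D' w y p) !D'E (con_Dr cD) (con_Zr cD).
  rewrite -[LHS]/((anchor (w p) (fun=> a) *: x p + a *: D w x p) + D w y p).
  by rewrite tangent_cst scale0r add0r.
- move=> s t f ss st sf p.
  rewrite -[LHS]/(cov D' (SmoothSec ss) (SmoothFunction sf *: SmoothSec st) p).
  rewrite -[RHS]/(anchor (s p) f *: t p + f p *: cov D' (SmoothSec ss) (SmoothSec st) p).
  by rewrite !D'E (con_Zr cD).
- move=> s t t' ss st st' p.
  rewrite -[RHS]/(b (cov D' (SmoothSec ss) (SmoothSec st) p) (t' p)
    + b (t p) (cov D' (SmoothSec ss) (SmoothSec st') p)) !D'E.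
  exact: (congr1 (fun f : A => f p) (con_metric cD (SmoothSec ss) (SmoothSec st) (SmoothSec st'))).
Qed.

End Correspondence.

Theorem theorem8 (R : realType) (n : nat) (M : manifold R n) (r : nat)
    (E : courant_algebroid M r) (hE : odd_exact E)
    (Em : forall p : M, {vspace E p}) (F : endo E)
    (hGF : Bn_almost_pseudo_Hermitian Em F) :
  pseudo_Hermitian_integrable Em F <->
  exists D : connection_op E,
    [/\ generalized_connection D,
        torsion_free D,
        preserves_form D (gmetric Em) &
        preserves_endo D F].
Proof.
have [gm acF comm] := hGF.
have sF := Bn_smooth acF.
have [u [eps acx]] := almost_complex_ssec acF sF.
have iK := involution_ssec gm.
pose C := courant_sections E.
pose K := ssec_endo (smooth_Gend gm); pose Fx := ssec_endo sF.
have KF x : K (Fx x) = Fx (K x).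
  apply: ssecP => p; have := congr1 (fun B : 'End(E p) => B (x p)) (comm p).
  by rewrite !comp_lfunE.
have acKF := almost_complex_involution acx iK KF.
have KFE := ssec_endo_comp (smooth_Gend gm) sF.
have intF := integrable_closed acx.
have intGF : Defs.integrable (fun p => (Gend Em p \o F p)%VF) <->
    closed_eigenbundle C (fun x => K (Fx x)) u.
  rewrite -[X in closed_eigenbundle _ X]KFE.
  by apply: (@integrable_closed _ _ _ _ _ _ _ u eps); rewrite KFE.
split=> [[iF iGF]|[D [gc tf pf pe]]].
  have [a sa ha] := smooth_lift_exists gm.
  have [a' sa' haa] := smooth_adjoint_exists sa.
  have [|||||||||D [cD DF DK T0]] := @exists_parallel_torsion_free _ _ C
      Fx K (ssec_endo sa) (ssec_endo sa') u eps acx iK KF.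
  - exact/intF.
  - exact/intGF.
  - exact: ssec_endoD.
  - exact: ssec_endoZ.
  - by move=> x y; apply: sfunP => p; exact: haa.
  - by move=> x; apply: ssecP => p; apply/(Gend_Em gm); exact: (ha p (x p)).1.
  - move=> x Kx; apply: ssecP => p; apply: (gm_anchor_inj gm); first exact: (ha p (x p)).1.
      by apply/(Gend_Em gm); exact: (congr1 (fun y : smooth_sec E => y p) Kx).
    exact: (ha p (x p)).2.
  - by move=> x f; apply: sfunP => p; apply: (ha p (x p)).2; exact: sfun_smooth.
  - move=> x x0; apply: ssecP => p.
    apply: (gm_anchor_inj gm); [exact: (ha p (x p)).1|exact: mem0v|].
    move=> f sf; rewrite anchor0// (ha p (x p)).2//.
    exact: (congr1 (fun g : smooth_function M => g p) (x0 (SmoothFunction sf))).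
  have [D' gc' DE] := connection_of_ssec cD.
  exists D'; split=> //.
  - move=> s t w ss st sw p.
    have := congr1 (fun g : smooth_function M => g p)
      (T0 (SmoothSec ss) (SmoothSec st) (SmoothSec sw)).
    by rewrite /torsion !(DE (SmoothSec _) (SmoothSec _)).
  - move=> w s t sw ss st p; rewrite /cov_form /gmetric.
    (* DG = 0 is compatibility with the scalar product applied to [K X] and [Y], once [K] commutes
       with [D]. *)
    pose W := SmoothSec sw; pose X := SmoothSec ss; pose Y := SmoothSec st.
    have := congr1 (fun g : smooth_function M => g p) (con_metric cD W (K X) Y).
    rewrite (DK W X) (DE W X) (DE W Y) /= => ->.
    by rewrite addrAC addrK subrr.
  - move=> w s sw ss p; pose W := SmoothSec sw; pose X := SmoothSec ss.
    rewrite /cov_endo -[X in X - _]/(cov D' W (Fx X) p) (DE W (Fx X)) (DE W X) DF.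
    exact: subrr.
have cD := connection_ssec gc.
have DF : parallel (conn_ssec gc) Fx.
  move=> w x; apply: ssecP => p.
  have := pe _ _ (ssec_smooth w) (ssec_smooth x) p.
  by move=> /eqP; rewrite subr_eq0 => /eqP.
have DK : parallel (conn_ssec gc) K.
  (* Conversely, DG = 0 minus the compatibility for [K x] and [y] leaves D_w K x - K D_w x paired
     with an arbitrary [y]. *)
  move=> w x; apply: (ip_inj (C := C)) => y; apply: sfunP => p.
  have := pf _ _ _ (ssec_smooth w) (ssec_smooth x) (ssec_smooth y) p.
  have := congr1 (fun g : smooth_function M => g p) (con_metric cD w (K x) y).
  rewrite /cov_form /gmetric /= => -> /eqP.
  by rewrite addrAC addrK subr_eq0 => /eqP.
have DKF : parallel (conn_ssec gc) (fun x => K (Fx x)).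
  by move=> w x; rewrite DK DF.
have T0 x y z : tor C (conn_ssec gc) x y z = 0.
  by apply: sfunP => p; exact: tf (ssec_smooth x) (ssec_smooth y) (ssec_smooth z) p.
split.
  by apply/intF; exact: (torsion_free_closed acx DF T0).
by apply/intGF; exact: (torsion_free_closed acKF DKF T0).
Qed.
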